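(* Let $1<p<\infty$ and $\beta<p-1$. Then: (i) $W_0^{1,p}(\mathbb{R}_+,t^\beta)=\mathcal{A}^0_{p,t^\beta}=\mathcal{B}^0_{p,t^\beta}=\mathcal{C}^0_{p,t^\beta}=Y^{1,p}_{t^\beta}$. (ii) The mapping $Tr^0(u):=\lim_{t\to 0}u(t)$ is well defined as a functional on the whole space $W^{1,p}(\mathbb{R}_+,t^\beta)$. Moreover, $$\lim_{t\to 0}t^{\frac{\beta-(p-1)}{p}}\,|u(t)-Tr^0(u)|=0\quad\text{for every }u\in W^{1,p}(\mathbb{R}_+,t^\beta).$$ (iii) If $\beta\le -1$, then $W^{1,p}(\mathbb{R}_+,t^\beta)=W^{1,p}_0(\mathbb{R}_+,t^\beta)=\mathcal{B}^0_{p,t^\beta}$. In particular, $Tr^0$ annihilates the whole space $W^{1,p}(\mathbb{R}_+,t^\beta)$, and $$W^{1,p}(\mathbb{R}_+,t^\beta)=W_0^{1,p}(\mathbb{R}_+,t^\beta)=\mathcal{A}^0_{p,t^\beta}=\mathcal{B}^0_{p,t^\beta}=\mathcal{C}^0_{p,t^\beta}=Y^{1,p}_{t^\beta}.$$ (iv) If $\beta\in(-1,p-1)$, then $Tr^0:W^{1,p}(\mathbb{R}_+,t^\beta)\to\mathbb{R}$ is an epimorphism (i.e. surjective). Moreover, $$W^{1,p}(\mathbb{R}_+,t^\beta)\supsetneq W_0^{1,p}(\mathbb{R}_+,t^\beta)=\mathcal{A}^0_{p,t^\beta}=\mathcal{B}^0_{p,t^\beta}=\mathcal{C}^0_{p,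t^\beta}=Y^{1,p}_{t^\beta}.$$
   Context: $\mathbb{R}_+=(0,\infty)$; functions are real valued. For $1\le p<\infty$ and $\beta\in\mathbb{R}$: $W^{1,p}(\mathbb{R}_+,t^\beta)$ is the Banach space of all $u\in W^{1,1}_{loc}(\mathbb{R}_+)$ with finite norm $$\|u\|_{W^{1,p}(\mathbb{R}_+,t^\beta)}=\Big(\int_{\mathbb{R}_+}|u(t)|^pt^\beta dt\Big)^{1/p}+\Big(\int_{\mathbb{R}_+}|u'(t)|^pt^\beta dt\Big)^{1/p}.$$ $Y^{1,p}_{t^\beta}$ is the Banach space of all $u\in W^{1,1}_{loc}(\mathbb{R}_+)$ with finite norm $$\|u\|_{Y^{1,p}_{t^\beta}}=\Big(\int_{\mathbb{R}_+}|u(t)|^pt^\beta\big(1+\tfrac{1}{t^p}\big)dt\Big)^{1/p}+\Big(\int_{\mathbb{R}_+}|u'(t)|^pt^\beta dt\Big)^{1/p}.$$ Elements of $W^{1,1}_{loc}(\mathbb{R}_+)$ are identified with their continuous representatives on $\mathbb{R}_+$. $W_0^{1,p}(\mathbb{R}_+,t^\beta)$ denotes the completion (closure) of $C_0^\infty(\mathbb{R}_+)$, the smooth functions with compact support in $(0,\infty)$, in $W^{1,p}(\mathbb{R}_+,t^\beta)$. Define the sets $$\mathcal{A}^0_{p,t^\beta}=\{u\in W^{1,p}(\mathbb{R}_+,t^\beta):\ \text{there exists } t_n\searrow 0 \text{ with } \lim_{n\to\infty}u(t_n)=0\},$$ $$\mathcal{B}^0_{p,t^\beta}=\{u\in W^{1,p}(\mathbb{R}_+,t^\beta):\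 \lim_{t\to0}u(t)=0\},$$ $$\mathcal{C}^0_{p,t^\beta}=\{u\in W^{1,p}(\mathbb{R}_+,t^\beta):\ \lim_{t\to0}u(t)\,t^{(\beta-p+1)/p}=0\}.$$ All equalities and inclusions between spaces are as sets of functions. ''Well defined'' for $Tr^0$ means that the limit exists as a finite real number for each $u$ in the space. *)

(* Defs.v *)
From HB Require Import structures.
From mathcomp Require Export all_boot all_order all_algebra.
From mathcomp Require Export all_classical all_reals all_analysis.
Set Implicit Arguments.
Unset Strict Implicit.
Unset Printing Implicit Defensive.
Import Order.TTheory GRing.Theory Num.Theory.
Import numFieldNormedType.Exports.

Local Open Scope classical_set_scope.
Local Open Scope ring_scope.

(* A function on (0, +oo) is represented by a function R -> R whose values on
   ]-oo, 0] are irrelevant: membership in W11loc, W1p, Y1p, W1p0, A0, B0 and C0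
   only depends on the restriction to (0, +oo), so that equality of these sets
   is equality of sets of functions on (0, +oo). *)
Definition Rpos {R : realType} : set R := `]0, +oo[.

(* C_0^oo(R_+); its elements are represented by their (smooth) extension
   by 0 to R. *)
Definition test_function {R : realType} (phi : R -> R) : Prop :=
  [/\ forall (n : nat) (t : R), derivable (derive1n n phi) t 1,
      compact (closure [set t | phi t != 0]) &
      closure [set t | phi t != 0] `<=` Rpos].

Definition is_weak_derivative {R : realType} (u v : R -> R) : Prop :=
  [/\ locally_integrable Rpos u, locally_integrable Rpos v &
      forall phi : R -> R, test_function phi ->
        \int[lebesgue_measure]_(t in Rpos) (u t * derive1 phi t) =
        - \int[lebesgue_measure]_(t in Rpos) (v t * phi t)].

(* W^{1,1}_loc(R_+), an element being identified with its continuous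
   representative on R_+. *)
Definition W11loc (R : realType) : set (R -> R) :=
  [set u | {in Rpos, continuous u} /\ exists v, is_weak_derivative u v].
Arguments W11loc R : clear implicits.

(* A chosen representative of u', which is unique up to a null set. The
   default value is never used for u in W11loc. *)
Definition weak_derivative {R : realType} (u : R -> R) : R -> R :=
  xget (fun=> 0) [set v | is_weak_derivative u v].

(* ( \int_0^oo |f(t)|^p w(t) dt )^(1/p) *)
Definition weighted_Lp {R : realType} (p : R) (w f : R -> R) : \bar R :=
  ((\int[lebesgue_measure]_(t in Rpos) (`|f t| `^ p * w t)%:E) `^ p^-1)%E.

Definition W1p_norm {R : realType} (p beta : R) (u : R -> R) : \bar R :=
  (weighted_Lp p (fun t => t `^ beta)%R u +
   weighted_Lp p (fun t => t `^ beta)%R (weak_derivative u))%E.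

Definition Y1p_norm {R : realType} (p beta : R) (u : R -> R) : \bar R :=
  (weighted_Lp p (fun t => t `^ beta * (1 + 1 / t `^ p))%R u +
   weighted_Lp p (fun t => t `^ beta)%R (weak_derivative u))%E.

Definition W1p {R : realType} (p beta : R) : set (R -> R) :=
  [set u | W11loc R u /\ (W1p_norm p beta u < +oo)%E].

Definition Y1p {R : realType} (p beta : R) : set (R -> R) :=
  [set u | W11loc R u /\ (Y1p_norm p beta u < +oo)%E].

Definition W1p0 {R : realType} (p beta : R) : set (R -> R) :=
  [set u | W1p p beta u /\
    forall e : R, 0 < e ->
      exists2 phi, test_function phi &
        (W1p_norm p beta (u \- phi)%R < e%:E)%E].

Definition A0 {R : realType} (p beta : R) : set (R -> R) :=
  [set u | W1p p beta u /\
    exists t_ : nat -> R,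
      [/\ forall n, 0 < t_ n, nonincreasing_seq t_,
          t_ n @[n --> \oo] --> 0 & u (t_ n) @[n --> \oo] --> 0]].

Definition B0 {R : realType} (p beta : R) : set (R -> R) :=
  [set u | W1p p beta u /\ u t @[t --> 0^'+] --> 0].

Definition C0 {R : realType} (p beta : R) : set (R -> R) :=
  [set u | W1p p beta u /\
    u t * t `^ ((beta - p + 1) / p) @[t --> 0^'+] --> 0].

(* Meaningful when the limit exists; otherwise an arbitrary value. *)
Definition Tr0 {R : realType} (u : R -> R) : R := lim (u t @[t --> 0^'+]).

(* Main.v *)
Require Import Defs.
From mathcomp Require Import all_boot all_order all_algebra.
From mathcomp Require Import all_classical all_reals all_analysis.
From mathcomp Require Import measurable_realfun ring lra.
Import Order.TTheory GRing.Theory Num.Theory.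
Import numFieldNormedType.Exports.

Local Open Scope classical_set_scope.
Local Open Scope ring_scope.

Set Implicit Arguments.
Unset Strict Implicit.
Unset Printing Implicit Defensive.

(** The proof rests on the fundamental theorem of calculus for continuous
functions with a weak derivative ([weak_derivative_FTC]), and on Hölder's
inequality with weights ([weighted_hoelder]): as beta < p - 1, the function
x^(-beta/(p-1)) is integrable at 0, and therefore

  (int_0^t |u'|)^p <= C t^(p-1-beta) int_0^t |u'|^p x^beta dx.

Hence u' is integrable at 0 and u has a limit L there, with
|u t - L| <= int_0^t |u'| ([trace_exists]).  The integral on the right of the
display tends to 0 with t, so that t^((beta-p+1)/p) |u t - L| tends to 0
([trace_weighted_cvg]).  Therefore A0, B0 and C0 coincide: the limit at 0
exists, and each of the three conditions says that it is 0.

If L = 0, then |u t| <= int_0^t |u'|, and Hardy's inequality ([hardy]) bounds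
the integral of |u|^p t^(beta-p) by that of |u'|^p t^beta, so that B0 is
contained in Y1p.  Conversely, near 0 a function with a nonzero limit is not
p-integrable for a weight t^g with g <= -1 ([energy_div]).  With g = beta - p
this shows that Y1p is contained in B0; with g = beta, if beta <= -1, it shows
that all of W1p is.

The trace L is controlled by the norm of u ([trace_norm_bound]) and vanishes
on test functions, so it vanishes on their closure W1p0.  It remains to
approximate u in Y1p by test functions ([test_function_density]).  Multiply u
by smooth functions chi_n that vanish near 0 and near infinity.  The new term
chi_n' u in the derivative is at most a constant times |u|/x, and
|u|^p x^(beta-p) is integrable, so dominated convergence applies.  On the
support of chi_n, which is a compact subset of the half-line, u' is
approximated in L^p by a smooth function h, and u by the antiderivative of h
that agrees with u at the left end of the support; chi_n times this
antiderivative is a test function close to u.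

If beta > -1, the weight t^beta is integrable at 0, so that smooth functions
equal to a prescribed constant near 0 and to 0 near infinity belong to W1p:
the trace is onto, and its kernel B0 is a proper subset ([trace_surj]). *)

(** * Smooth functions *)

Section smooth_functions.
Context {R : realType}.
Implicit Types (f g h : R -> R) (n : nat) (c t x : R).

(** The recursion is on the derivative of f, not on the last of the iterated
derivatives, so that closure properties are inductions on n. *)
Fixpoint n_derivable n f : Prop :=
  if n is m.+1 then (forall t, derivable f t 1) /\ n_derivable m (derive1 f) else True.

Definition smooth f := forall n, n_derivable n f.

Lemma n_derivableS n f : n_derivable n.+1 f -> n_derivable n f.
Proof.
elim: n f => [//|n IH] f [df df'].
by split => //; exact: IH.
Qed.

Lemma is_derive_n_derivable n f g :
  (forall t, is_derive t 1 f (g t)) -> n_derivable n g -> n_derivable n.+1 f.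
Proof.
move=> fg gn; split; first by move=> t; have [] := fg t.
have -> // : (derive1 f) = g by apply/funext => t; rewrite derive1E; exact: derive_val.
Qed.

Lemma is_derive_smooth f g :
  (forall t, is_derive t 1 f (g t)) -> smooth g -> smooth f.
Proof.
move=> fg sg n; apply: n_derivableS.
exact: is_derive_n_derivable fg (sg n).
Qed.

Lemma smooth_derive f : smooth f -> smooth (derive1 f).
Proof. by move=> sf n; case: (sf n.+1). Qed.

Lemma smooth_is_derive f : smooth f -> forall t, is_derive t 1 f ((derive1 f) t).
Proof. by move=> sf t; rewrite derive1E; apply: derivableP; case: (sf 1). Qed.

Lemma smooth_continuous f : smooth f -> continuous f.
Proof.
move=> sf t; apply: differentiable_continuous; apply/derivable1_diffP.
by case: (sf 1).
Qed.

Lemma smooth_derive1n f :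
  smooth f <-> forall n t, derivable (derive1n n f) t 1.
Proof.
split=> [sf n t|df n].
  elim: n f sf => [|n IH] f sf; first by case: (sf 1).
  by rewrite /derive1n iterSr; apply: IH; exact: smooth_derive.
elim: n f df => [//|n IH] f df; split; first exact: (df 0).
by apply: IH => m t; have := df m.+1 t; rewrite /derive1n iterSr.
Qed.

Lemma n_derivable_cst n c : n_derivable n (cst c).
Proof.
elim: n c => [//|n IH] c.
by apply: (@is_derive_n_derivable _ _ (cst 0)); exact: IH.
Qed.

Lemma n_derivableD n f g :
  n_derivable n f -> n_derivable n g -> n_derivable n (f \+ g).
Proof.
elim: n f g => [//|n IH] f g [df nf] [dg ng].
apply: (@is_derive_n_derivable _ _ ((derive1 f) \+ (derive1 g))); last exact: IH.
by move=> t; rewrite /= !derive1E; apply: is_deriveD; exact: derivableP.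
Qed.

Lemma n_derivableM n f g :
  n_derivable n f -> n_derivable n g -> n_derivable n (f \* g).
Proof.
elim: n f g => [//|n IH] f g nf ng.
have [[df f'n] [dg g'n]] := (nf, ng).
apply: (@is_derive_n_derivable _ _ ((f \* (derive1 g)) \+ (g \* (derive1 f)))); last first.
  by apply: n_derivableD; apply: IH => //; exact: n_derivableS.
by move=> t; rewrite /= !derive1E; apply: is_deriveM; exact: derivableP.
Qed.

Lemma n_derivable_affine n f a b :
  n_derivable n f -> n_derivable n (fun x => f (a * x + b)).
Proof.
elim: n f => [//|n IH] f [df nf].
apply: (@is_derive_n_derivable _ _ (cst a \* (fun x => (derive1 f) (a * x + b)))).
  move=> t; rewrite /= derive1E mulrC.
  have : is_derive t (1:R) (fun x : R => a * x + b) a.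
    by apply: is_derive_eq; rewrite addr0 /GRing.scale/= mulr1.
  move=> H.
  have := @is_derive1_comp _ f (fun x : R => a * x + b) t _ _ (derivableP (df _)) H.
  by rewrite /GRing.scale /= mulrC.
by apply: n_derivableM; [exact: n_derivable_cst|exact: IH].
Qed.

Lemma smooth_cst c : smooth (cst c).
Proof. by move=> n; exact: n_derivable_cst. Qed.

Lemma smoothD f g : smooth f -> smooth g -> smooth (f \+ g).
Proof. by move=> sf sg n; exact: n_derivableD. Qed.

Lemma smoothM f g : smooth f -> smooth g -> smooth (f \* g).
Proof. by move=> sf sg n; exact: n_derivableM. Qed.

Lemma smooth_affine f a b : smooth f -> smooth (fun x => f (a * x + b)).
Proof. by move=> sf n; exact: n_derivable_affine. Qed.

Lemma smoothZ c f : smooth f -> smooth (fun x => c * f x).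
Proof. by move=> sf; apply: smoothM => //; exact: smooth_cst. Qed.

Lemma smoothB f g : smooth f -> smooth g -> smooth (f \- g).
Proof.
move=> sf sg; have -> : f \- g = f \+ (fun x => (-1) * g x).
  by apply/funext => x /=; rewrite mulN1r.
by apply: smoothD => //; exact: smoothZ.
Qed.

Lemma smooth_sum (I : Type) (r : seq I) (F : I -> R -> R) :
  (forall i, smooth (F i)) -> smooth (fun x => \sum_(i <- r) F i x).
Proof.
move=> sF; elim: r => [|i r IH].
  by under eq_fun do rewrite big_nil; exact: smooth_cst.
by under eq_fun do rewrite big_cons; exact: smoothD.
Qed.

End smooth_functions.

(** * Antiderivatives of continuous functions *)

Section antiderivative.
Context {R : realType}.
Notation mu := (@lebesgue_measure R).
Implicit Types (f : R -> R) (a b x : R).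

Lemma continuous_integrable_itv f a b :
  continuous f -> mu.-integrable `[a, b] (EFin \o f).
Proof.
move=> cf; apply: continuous_compact_integrable; first exact: segment_compact.
exact: continuous_subspaceT.
Qed.

(** The integral over [0, x] is 0 for x < 0; the second term gives the
antiderivative its values there, so that it is defined on the whole line. *)
Definition antiderivative f x :=
  (\int[mu]_(t in `[0, x]) f t - \int[mu]_(t in `[x, 0]) f t)%R.

Lemma antiderivative0 f : antiderivative f 0 = 0.
Proof. by rewrite /antiderivative subrr. Qed.

Lemma Rintegral_itv_split f a b c : a <= b -> b <= c ->
  mu.-integrable `[a, c] (EFin \o f) ->
  (\int[mu]_(t in `[a, c]) f t =
   \int[mu]_(t in `[a, b]) f t + \int[mu]_(t in `[b, c]) f t)%R.
Proof.
move=> ab bc fi.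
have := @Rintegral_itvB _ f (BLeft a) (BRight c) b fi.
rewrite !bnd_simp => /(_ ab bc) /eqP; rewrite subr_eq => /eqP ->.
rewrite addrC; congr (_ + _); apply: Rintegral_itv_obnd_cbnd.
apply: integrableS fi => //; apply: subset_itv; rewrite bnd_simp //.
Qed.

(** Differentiability at a point is only known for an integral that starts
strictly to the left of the point, which calls for other base points than 0. *)
Lemma antiderivativeE f a x : continuous f -> a <= 0 -> a <= x ->
  antiderivative f x =
  (\int[mu]_(t in `[a, x]) f t - \int[mu]_(t in `[a, 0]) f t)%R.
Proof.
move=> cf a0 ax; have fi := continuous_integrable_itv _ _ cf.
rewrite /antiderivative; have [x0|x0] := leP 0 x.
  rewrite (@Rintegral_itv_split f a 0 x)// addrAC subrr add0r.
  move: x0; rewrite le_eqVlt => /predU1P[<-|x0].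
    by rewrite set_itv1 Rintegral_set1 subrr.
  by rewrite (set_itv_ge (b1 := BLeft x)) ?Rintegral_set0 ?subr0// bnd_simp -ltNge.
rewrite (@Rintegral_itv_split f a x 0)//; last exact: ltW.
rewrite opprD addrA subrr set_itv_ge ?Rintegral_set0// bnd_simp -ltNge//.
Qed.

Lemma is_derive_near_subr (f g : R -> R) c x d :
  is_derive x 1 f d -> (\near x, f x - c = g x) -> is_derive x 1 g d.
Proof.
move=> fd fg; apply: near_eq_is_derive fg _.
by rewrite -[d]subr0; apply: is_deriveB.
Qed.

Lemma is_derive_antiderivative f x :
  continuous f -> is_derive x 1 (antiderivative f) (f x).
Proof.
move=> cf; pose a : R := Num.min x 0 - 1.
have ax : a < x by rewrite /a ltrBlDr; have := ge_min x x (0:R); lra.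
have a0 : a <= 0 by rewrite /a lerBlDr; have := ge_min 0 x (0:R); lra.
have [] := @continuous_FTC1 R f (BLeft a) x (x + 1) ltac:(lra)
  (continuous_integrable_itv _ _ cf).
- exact: ax.
- exact: cf.
move=> dF F'.
pose F y := (\int[mu]_(t in `[a, y]) f t)%R.
have FE : \forall y \near x, F y - (\int[mu]_(t in `[a, 0]) f t)%R = antiderivative f y.
  near=> y; rewrite -antiderivativeE//.
  by near: y; apply: filterS (lt_nbhsr ax) => ? /ltW.
apply: is_derive_near_subr FE; split; first exact: dF.
by rewrite -derive1E.
Unshelve. all: by end_near. Qed.

End antiderivative.

(** * A smooth step function *)

Section smooth_step.
Context {R : realType}.
Notation mu := (@lebesgue_measure R).
Implicit Types (k n : nat) (t x y : R).

(** The functions x^(-k) exp(-1/x), for all k at once: the derivative of each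
is a combination of two others, so that smoothness, even at 0, is an induction
that needs the first derivative only. *)
Definition flat k x : R := if 0 < x then x^-1 ^+ k * expR (- x^-1) else 0.

Lemma flat_le0 k x : x <= 0 -> flat k x = 0.
Proof. by rewrite /flat leNgt => /negbTE ->. Qed.

Lemma flat_ge0 k x : 0 <= flat k x.
Proof.
rewrite /flat; case: ifPn => // x0.
by rewrite mulr_ge0 ?expR_ge0// exprn_ge0// invr_ge0 ltW.
Qed.

Lemma flat_gt0 k x : 0 < x -> 0 < flat k x.
Proof.
move=> x0; rewrite /flat x0 mulr_gt0 ?expR_gt0// exprn_gt0// invr_gt0//.
Qed.

(** This is exp y >= y^(k+1)/(k+1)! for y = 1/x. *)
Lemma flat_le_linear k x : 0 <= x -> flat k x <= k.+1`!%:R * x.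
Proof.
rewrite le_eqVlt => /predU1P[<-|x0]; first by rewrite flat_le0// mulr0.
have y0 : 0 < x^-1 by rewrite invr_gt0.
have := expR_ge1Dxn k (ltW y0); set y := x^-1 in y0 *.
have f0 : (0 : R) < k.+1`!%:R by rewrite ltr0n fact_gt0.
move=> H; rewrite /flat x0 -/y expRN ler_pdivrMr ?expR_gt0//.
have -> : x = y^-1 by rewrite /y invrK.
rewrite mulrAC ler_pdivlMr// -exprSr mulrC -ler_pdivrMr// mulrC.
by rewrite mulrC; apply: le_trans H; rewrite lerDr.
Qed.

Lemma is_derive_flat k x :
  is_derive x 1 (flat k) (- k%:R * flat k.+1 x + flat k.+2 x).
Proof.
have [x0|x0|->] := ltgtP x 0.
- rewrite !flat_le0 ?(ltW x0)// mulr0 addr0.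
  apply: (@near_eq_is_derive _ _ _ (cst 0)).
  near=> y; rewrite flat_le0//; near: y.
  by apply: filterS (lt_nbhsl x0) => ? /ltW.
- apply: (@near_eq_is_derive _ _ _ (fun y => y^-1 ^+ k * expR (- y^-1))).
    near=> y; rewrite /flat ifT//; near: y; exact: lt_nbhsr.
  have xn0 : x != 0 by rewrite gt_eqF.
  have dV : is_derive x 1 (fun y : R => y^-1) (- x ^- 2).
    have := @is_deriveV R id x 1 1 xn0 (is_derive_id _ _).
    by rewrite /GRing.scale/= mulr1.
  have := is_deriveM (is_deriveX k dV) (is_derive1_comp (is_derive_expR _) (is_deriveN dV)).
  have -> : flat k.+1 x = x^-1 ^+ k.+1 * expR (- x^-1) by rewrite /flat x0.
  have -> : flat k.+2 x = x^-1 ^+ k.+2 * expR (- x^-1) by rewrite /flat x0.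
  have -> : (fun y => y^-1 ^+ k * expR (- y^-1)) =
      (@GRing.inv R) ^+ k * (expR \o - (@GRing.inv R)).
    by apply/funext => y; rewrite exprfctE.
  move=> [dF dE]; split; first exact: dF.
  apply: (etrans dE).
  rewrite exprfctE /=.
  rewrite /GRing.scale/= -!exprVn opprK.
  rewrite (_ : (- @GRing.inv R) x = - x^-1)//.
  by case: k {dF dE} => [|k]; rewrite /= !exprS ?expr0; ring.
(* At 0, the difference quotient of flat k is flat k.+1, which tends to 0. *)
- rewrite !flat_le0// mulr0 addr0.
  have H : h^-1 *: (flat k (h *: 1 + 0) - flat k 0) @[h --> 0^'] --> (0 : R).
    apply/cvgrPdist_le => e e0; near=> h.
    rewrite sub0r normrN (@flat_le0 k 0)// subr0 addr0 /GRing.scale/= mulr1.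
    have [h0|h0] := leP h 0; first by rewrite flat_le0// mulr0 normr0 ltW.
    have -> : h^-1 * flat k h = flat k.+1 h.
      by rewrite /flat h0 exprS mulrA.
    rewrite ger0_norm ?flat_ge0//; apply: le_trans (flat_le_linear _ (ltW h0)) _.
    rewrite mulrC -ler_pdivlMr ?ltr0n ?fact_gt0//.
    rewrite -[h]ger0_norm ?(ltW h0)//; near: h.
    apply: dnbhs0_le; rewrite divr_gt0// ltr0n fact_gt0//.
  by split; [apply/cvg_ex; exists 0|apply/cvg_lim].
Unshelve. all: by end_near. Qed.

Lemma smooth_flat k : smooth (flat k).
Proof.
move=> n; elim: n k => [//|n IH] k.
apply: is_derive_n_derivable; first by move=> x; exact: is_derive_flat.
by apply: n_derivableD => //; apply: n_derivableM => //; exact: n_derivable_cst.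
Qed.

Definition bump x : R := flat 0 x * flat 0 (1 - x).

Lemma smooth_bump : smooth bump.
Proof.
apply: smoothM; first exact: smooth_flat.
have -> : (fun x => flat 0 (1 - x)) = (fun x => flat 0 (-1 * x + 1)).
  by apply/funext => x; rewrite mulN1r addrC.
by apply: smooth_affine; exact: smooth_flat.
Qed.

Lemma bump_ge0 x : 0 <= bump x.
Proof. by rewrite mulr_ge0// flat_ge0. Qed.

Lemma bump_gt0 x : 0 < x < 1 -> 0 < bump x.
Proof. by move=> /andP[x0 x1]; rewrite mulr_gt0// flat_gt0// subr_gt0. Qed.

Lemma bump_eq0 x : ~~ (0 < x < 1) -> bump x = 0.
Proof.
rewrite negb_and -!leNgt => /orP[x0|x1]; first by rewrite /bump flat_le0 ?mul0r.
by rewrite /bump [X in _ * X]flat_le0 ?mulr0// subr_le0.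
Qed.

Let F := antiderivative (@bump).

Let F_MVT x y : x < y -> exists2 z, x < z < y & F y - F x = bump z * (y - x).
Proof.
move=> xy.
have dF (z : R) : is_derive z 1 F (bump z).
  by apply: is_derive_antiderivative; exact: smooth_continuous smooth_bump.
have [|z zxy Fz] := @MVT R F bump x y xy (fun z _ => dF z).
  by apply: derivable_within_continuous => z _; have [] := dF z.
by exists z => //; move: zxy; rewrite in_itv.
Qed.

Let F1_gt0 : 0 < F 1.
Proof.
have [//|z z01] := @F_MVT 0 1 _.
rewrite [F 0]antiderivative0 subr0 => ->.
by rewrite subr0 mulr1 bump_gt0.
Qed.

(** This function increases from 0 to 1 on [0, 1] and is constant elsewhere;
the cutoffs, mollifiers and partitions of unity below are made of its
rescalings. *)
Definition step x : R := antiderivative bump x / antiderivative bump 1.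

Lemma is_derive_step x : is_derive x 1 step (bump x / F 1).
Proof.
rewrite mulrC.
have dF : is_derive x 1 F (bump x).
  by apply: is_derive_antiderivative; exact: smooth_continuous smooth_bump.
have -> : step = (F 1)^-1 *: F.
  by apply/funext => y; rewrite /step mulrC.
exact: is_deriveZ.
Qed.

Lemma derive1_step x : derive1 step x = bump x / F 1.
Proof. by rewrite derive1E; have /@derive_val -> := is_derive_step x. Qed.

Lemma smooth_step : smooth step.
Proof.
apply: is_derive_smooth; first exact: is_derive_step.
have -> : (fun x => bump x / F 1) = (fun x => (F 1)^-1 * bump x).
  by apply/funext => x; rewrite mulrC.
by apply: smoothZ; exact: smooth_bump.
Qed.

Lemma step_le0 x : x <= 0 -> step x = 0.
Proof.
rewrite /step le_eqVlt => /predU1P[->|x0]; first by rewrite antiderivative0 mul0r.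
have [z /andP[_ z0]] := F_MVT x0.
rewrite bump_eq0 ?negb_and -?leNgt ?(ltW z0)// mul0r.
rewrite [F 0]antiderivative0 sub0r => /eqP; rewrite oppr_eq0 => /eqP Fx.
by rewrite -/(F x) Fx mul0r.
Qed.

Lemma step_ge1 x : 1 <= x -> step x = 1.
Proof.
rewrite /step -!/(F _) le_eqVlt => /predU1P[<-|x1].
  by rewrite divff// gt_eqF.
have [z /andP[z1 _]] := F_MVT x1.
rewrite bump_eq0 ?negb_and -?leNgt ?(ltW z1) ?orbT// mul0r => /eqP.
by rewrite subr_eq0 => /eqP ->; rewrite divff// gt_eqF.
Qed.

Lemma derive1_step_ge0 x : 0 <= derive1 step x.
Proof. by rewrite derive1_step divr_ge0 ?bump_ge0// ltW. Qed.

Lemma derive1_step_eq0 x : ~~ (0 < x < 1) -> derive1 step x = 0.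
Proof. by move=> x01; rewrite derive1_step bump_eq0// mul0r. Qed.

Lemma step_homo : {homo step : x y / x <= y}.
Proof.
move=> x y; rewrite le_eqVlt => /predU1P[->//|xy].
have [z _ Fz] := F_MVT xy.
rewrite /step -!/(F _) ler_pM2r ?invr_gt0// -subr_ge0 Fz.
by rewrite mulr_ge0 ?bump_ge0// subr_ge0 ltW.
Qed.

Lemma step_ge0 x : 0 <= step x.
Proof.
have [x0|/ltW x0] := leP x 0; first by rewrite step_le0.
by rewrite -(@step_le0 0)//; exact: step_homo.
Qed.

Lemma step_le1 x : step x <= 1.
Proof.
have [x1|/ltW x1] := leP 1 x; first by rewrite step_ge1.
by rewrite -(@step_ge1 1)//; exact: step_homo.
Qed.

Lemma derive1_step_bounded : exists2 M, 0 < M & forall x, derive1 step x <= M.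
Proof.
exists (F 1)^-1 => [|x]; first by rewrite invr_gt0.
rewrite derive1_step ler_piMl ?invr_ge0 ?(ltW F1_gt0)//.
have [x01|/bump_eq0 -> //] := boolP (0 < x < 1).
have flat1 y : flat 0 y <= 1.
  rewrite /flat; case: ifPn => // y0.
  by rewrite expr0 mul1r expR_le1 oppr_le0 invr_ge0 ltW.
by rewrite mulr_ile1 ?flat_ge0.
Qed.

End smooth_step.
Arguments step {R} x.

(** * Integration on the half-line *)

Section domain_lemmas.
Context {R : realType}.
Notation mu := (@lebesgue_measure R).
Implicit Types (f g u v : R -> R) (a b c t x : R).

Lemma RposE x : (x \in (@Rpos R)) = (0 < x).
Proof. by rewrite /Rpos mem_setE in_itv/= andbT. Qed.

Lemma RposP x : (@Rpos R) x <-> 0 < x.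
Proof. by rewrite -RposE; split => [/mem_set|/set_mem]. Qed.

Lemma measurable_Rpos : measurable (@Rpos R : set (measurableTypeR R)).
Proof. exact: measurable_itv. Qed.

Lemma open_Rpos : open (@Rpos R).
Proof. exact: interval_open. Qed.

Lemma subset_itv_Rpos a b : 0 < a -> `[a, b] `<=` @Rpos R.
Proof.
by move=> a0 x /=; rewrite in_itv/= => /andP[ax _]; apply/RposP; lra.
Qed.

Lemma integrable_supported (D E : set R) f :
  measurable D -> measurable E -> E `<=` D ->
  (forall x, D x -> ~ E x -> f x = 0) ->
  mu.-integrable E (EFin \o f) -> mu.-integrable D (EFin \o f).
Proof.
move=> mD mE ED f0 /integrable_mkcond => /(_ mE) fE.
apply/integrable_mkcond => //; move: fE; congr (mu.-integrable _ _).
apply/funext => x; rewrite !patchE.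
case: ifPn => [/set_mem Ex|/negP xE]; first by rewrite mem_set//; exact: ED.
by case: ifPn => [/set_mem Dx|//] /=; rewrite f0// => /mem_set.
Qed.

Lemma integral_supported (D E : set R) (f : R -> \bar R) :
  E `<=` D -> (forall x, D x -> ~ E x -> f x = 0%E) ->
  (\int[mu]_(x in D) f x = \int[mu]_(x in E) f x)%E.
Proof.
move=> ED f0; rewrite integral_mkcond [RHS]integral_mkcond; congr integral.
apply/funext => x; rewrite !patchE.
case: ifPn => [/set_mem Dx|xD]; case: ifPn => [/set_mem Ex|/negP xE] //=.
  by rewrite f0// => /mem_set.
by move/negP: xD; case; apply/mem_set/ED.
Qed.

Lemma Rintegral_supported (D E : set R) f :
  E `<=` D -> (forall x, D x -> ~ E x -> f x = 0) ->
  (\int[mu]_(x in D) f x = \int[mu]_(x in E) f x)%R.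
Proof.
move=> ED f0; congr fine; apply: integral_supported => // x Dx nE.
by rewrite f0.
Qed.

Lemma continuous_bounded_on f a b : continuous f ->
  exists2 M, 0 < M & forall x, a <= x <= b -> `|f x| <= M.
Proof.
move=> cf; have [ab|ba] := leP a b; last first.
  by exists 1 => // x /andP[ax xb]; lra.
have [|c _ cM] := @EVT_max R (fun x => `|f x|) a b ab.
  apply: continuous_subspaceT => x.
  by apply: continuous_comp; [exact: cf|exact: norm_continuous].
exists (`|f c| + 1); first by rewrite ltr_wpDl.
by move=> x xab; apply: le_trans (cM x _) _; rewrite ?in_itv// lerDl.
Qed.

Lemma locally_integrable_itv u a b :
  locally_integrable Rpos u -> 0 < a -> mu.-integrable `[a, b] (EFin \o u).
Proof.
move=> [mu_ _ uK] a0; have sub := @subset_itv_Rpos a b a0.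
apply/integrableP; split.
  apply/measurable_EFinP; apply: measurable_funS mu_ => //; exact: measurable_Rpos.
by apply: uK => //; exact: segment_compact.
Qed.

Lemma continuous_locally_integrable u :
  {in Rpos, continuous u} -> locally_integrable Rpos u.
Proof.
move=> cu; split.
- apply: open_continuous_measurable_fun => //; exact: open_Rpos.
- exact: open_Rpos.
- move=> K KR cK.
  suff /integrableP[] : mu.-integrable K (EFin \o u) by [].
  apply: continuous_compact_integrable => //.
  by apply: continuous_in_subspaceT => x /set_mem Kx; apply: cu; rewrite RposE; apply/RposP/KR.
Qed.

Lemma integrable_mul_test u f a b : locally_integrable Rpos u ->
  continuous f -> 0 < a -> (forall x, ~~ (a <= x <= b) -> f x = 0) ->
  mu.-integrable Rpos (EFin \o (fun x => u x * f x)).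
Proof.
move=> lu cf a0 f0.
apply: (@integrable_supported _ `[a, b]) => //.
- exact: measurable_Rpos.
- exact: subset_itv_Rpos.
- by move=> x _ /= /negP; rewrite in_itv/= => xab; rewrite f0 ?mulr0.
apply: (@integrableMl _ _ _ mu _ _ (EFin \o u) f) => //.
- exact: locally_integrable_itv.
- by apply: measurable_funTS; exact: continuous_measurable_fun.
have [M M0 fM] := continuous_bounded_on a b cf.
exists M; split; first exact: num_real.
by move=> y My x /= xab; apply: le_trans (fM _ xab) (ltW My).
Qed.

Lemma dominated_cvg_EFin (D : set R) (f_ : nat -> R -> R) f g :
  measurable D -> (forall n, measurable_fun D (f_ n)) -> measurable_fun D f ->
  (forall x, D x -> f_ n x @[n --> \oo] --> f x) ->
  mu.-integrable D (EFin \o g) -> (forall n x, D x -> `|f_ n x| <= g x) ->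
  (\int[mu]_(x in D) (f_ n x)%:E @[n --> \oo] --> \int[mu]_(x in D) (f x)%:E)%E.
Proof.
move=> mD mf_ mf ff ig fg.
have [] := @dominated_convergence _ _ R mu D mD (fun n => EFin \o f_ n)
  (EFin \o f) (EFin \o g).
- by move=> n; apply/measurable_EFinP; exact: mf_.
- by apply/measurable_EFinP; exact: mf.
- by apply: aeW => x Dx; apply: cvg_EFin; [exact: nearW|exact: ff].
- exact: ig.
- by apply: aeW => x n Dx; rewrite lee_fin; exact: fg.
- by move=> _ _.
Qed.

Lemma dominated_cvg_Rintegral (D : set R) (f_ : nat -> R -> R) f g :
  measurable D -> (forall n, measurable_fun D (f_ n)) -> measurable_fun D f ->
  (forall x, D x -> f_ n x @[n --> \oo] --> f x) ->
  mu.-integrable D (EFin \o g) -> (forall n x, D x -> `|f_ n x| <= g x) ->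
  (\int[mu]_(x in D) (f_ n x) @[n --> \oo] --> \int[mu]_(x in D) (f x))%R.
Proof.
move=> mD mf_ mf ff ig fg.
apply: fine_cvg; rewrite fineK; first exact: (dominated_cvg_EFin mD mf_ mf ff ig).
apply: integrable_fin_num => //; apply: le_integrable ig => //.
  by apply/measurable_EFinP; exact: mf.
move=> x Dx /=; rewrite lee_fin; apply: le_trans (ler_norm _).
have := ff _ Dx => /(cvg_norm) H; rewrite -(cvg_lim _ H)//.
apply: limr_le; first by apply/cvg_ex; exists `|f x|.
by apply: nearW => n; exact: fg.
Qed.

Lemma Rintegral_derive1 f a b : smooth f -> a <= b ->
  (\int[mu]_(x in `[a, b]) (derive1 f x) = f b - f a)%R.
Proof.
move=> sf; rewrite le_eqVlt => /predU1P[->|ab].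
  by rewrite set_itv1 Rintegral_set1 subrr.
rewrite /Rintegral (@continuous_FTC2 R (derive1 f) f)//.
- by apply: continuous_subspaceT; exact/smooth_continuous/smooth_derive.
- split.
  + by move=> x _; have [] := smooth_is_derive sf x.
  + by apply: cvg_at_right_filter; exact: smooth_continuous.
  + by apply: cvg_at_left_filter; exact: smooth_continuous.
Qed.

End domain_lemmas.

(** * The fundamental theorem of calculus for weak derivatives *)

Section weak_derivatives.
Context {R : realType}.
Notation mu := (@lebesgue_measure R).
Implicit Types (f g u v w phi : R -> R) (a b c t x : R) (n : nat).

(** A compact subset of the open half-line lies in an interval [a, b] with
0 < a; the proofs below use supports in this form. *)
Lemma test_functionP phi : test_function phi <->
  smooth phi /\
  exists a b, [/\ 0 < a, a < b & forall x, ~~ (a <= x <= b) -> phi x = 0].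
Proof.
split=> [[dphi cK KR]|[sphi [a [b [a0 ab phi0]]]]].
  split; first exact/smooth_derive1n.
  set K := closure _ in cK KR.
  have [M [_ KM]] := compact_bounded cK.
  have K0 : nbhs (0 : R) (~` K).
    apply: open_nbhs_nbhs; split; first by apply: closed_openC; exact: closed_closure.
    by move=> /KR /RposP; rewrite ltxx.
  have [e /= e0 eK] := K0.
  exists (e / 2), (e / 2 + `|M| + 1); split; first lra.
    by have := normr_ge0 M; lra.
  move=> x; apply: contraNeq => px.
  have Kx : K x by exact: subset_closure.
  have x0 : 0 < x by have /RposP := KR _ Kx.
  have xM : `|x| <= `|M| + 1.
    apply: (KM (`|M| + 1)) => //.
    by apply: le_lt_trans (ler_norm _) _; rewrite ltrDl.
  rewrite gtr0_norm// in xM.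
  have [ex|xe] := leP (e / 2) x; first by rewrite ?ex/=; lra.
  exfalso; apply: (eK x) => //=; rewrite sub0r normrN gtr0_norm//; lra.
have sub : closure [set t | phi t != 0] `<=` `[a, b].
  have -> : `[a, b]%classic = closure `[a, b].
    by apply: (iffLR (closure_id _)); exact: interval_closed.
  apply: closureS => x /=; rewrite in_itv/=; apply: contraR => /phi0 ->.
  by rewrite eqxx.
split; first exact/smooth_derive1n.
- apply: subclosed_compact sub; first exact: closed_closure.
  exact: segment_compact.
- by move=> x /sub; exact: subset_itv_Rpos.
Qed.

Lemma derive1_supported f a b :
  (forall x, ~~ (a <= x <= b) -> f x = 0) ->
  forall x, ~~ (a <= x <= b) -> derive1 f x = 0.
Proof.
move=> f0 x; rewrite negb_and -!ltNge => xab.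
rewrite derive1E; apply: derive_val.
apply: (@near_eq_is_derive _ _ _ (cst 0)).
case/orP: xab => xab; near=> y; rewrite f0// negb_and -!ltNge; apply/orP.
  by left; near: y; exact: lt_nbhsl.
by right; near: y; exact: lt_nbhsr.
Unshelve. all: by end_near. Qed.

Lemma derive1_affine f c b x : smooth f ->
  derive1 (fun x => f (c * x + b)) x = c * derive1 f (c * x + b).
Proof.
move=> sf; rewrite derive1E mulrC; apply: derive_val.
have H : is_derive x (1:R) (fun x : R => c * x + b) c.
  by apply: is_derive_eq; rewrite addr0 /GRing.scale/= mulr1.
exact: (@is_derive1_comp _ f (fun x : R => c * x + b) x _ _
  (smooth_is_derive sf _) H).
Qed.

Lemma derive1B f g x : smooth f -> smooth g ->
  derive1 (f \- g) x = derive1 f x - derive1 g x.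
Proof.
move=> sf sg; rewrite derive1E; apply: derive_val.
by apply: is_deriveB; exact: smooth_is_derive.
Qed.

(** These functions approximate the Dirac mass at c. They are supported in
[c, c + 1/(n+1)], to the right of c, and are the derivatives of the functions
ramp n c, which approximate the indicator function of ]c, +oo[. *)
Let kernel n c x : R := n.+1%:R * derive1 step (n.+1%:R * x - n.+1%:R * c).

Let ramp n c x : R := step (n.+1%:R * x - n.+1%:R * c).

Let ramp_eq0 n c x : x <= c -> ramp n c x = 0.
Proof.
by move=> xc; rewrite /ramp step_le0// -mulrBr pmulr_rle0 ?ltr0n// subr_le0.
Qed.

Let ramp_eq1 n c x : c + n.+1%:R^-1 <= x -> ramp n c x = 1.
Proof.
move=> cx; rewrite /ramp step_ge1// -mulrBr mulrC -ler_pdivrMr ?ltr0n//.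
by rewrite div1r lerBrDl.
Qed.

Let ramp_cvg c x : ramp n c x @[n --> \oo] --> ((c < x)%R%:R : R).
Proof.
have [cx|xc] := ltP c x; last first.
  by under eq_fun do rewrite ramp_eq0//; exact: cvg_cst.
have xc0 : 0 < x - c by rewrite subr_gt0.
apply: cvg_near_cst; near=> n; rewrite ramp_eq1// -lerBrDl ltW//.
by near: n; exact: near_infty_natSinv_lt (PosNum xc0).
Unshelve. all: by end_near. Qed.

Let smooth_ramp n c : smooth (ramp n c).
Proof. by apply: smooth_affine; exact: smooth_step. Qed.

Let derive1_ramp n c : derive1 (ramp n c) = kernel n c.
Proof. by apply/funext => x; rewrite derive1_affine//; exact: smooth_step. Qed.

Let smooth_kernel n c : smooth (kernel n c).
Proof. by rewrite -derive1_ramp; exact: smooth_derive. Qed.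

Let kernel_ge0 n c x : 0 <= kernel n c x.
Proof. by rewrite mulr_ge0// derive1_step_ge0. Qed.

Let kernel_eq0 n c x : ~~ (c <= x <= c + n.+1%:R^-1) -> kernel n c x = 0.
Proof.
move=> xc; rewrite /kernel derive1_step_eq0 ?mulr0//; apply: contraNN xc.
rewrite -mulrBr pmulr_rgt0 ?ltr0n// subr_gt0 => /andP[cx].
rewrite mulrC -ltr_pdivlMr ?ltr0n// div1r ltrBlDl => xc.
by rewrite !ltW.
Qed.

Let int_kernel n c : (\int[mu]_(x in `[c, (c + n.+1%:R^-1)%R]) kernel n c x = 1)%R.
Proof.
rewrite -derive1_ramp Rintegral_derive1//; last by rewrite lerDl invr_ge0.
rewrite /ramp mulrDr mulfV ?pnatr_eq0// addrAC subrr add0r.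
by rewrite step_ge1// step_le0// subr0.
Qed.

Let int_kernel_cvg u c : {in Rpos, continuous u} -> 0 < c ->
  (\int[mu]_(x in Rpos) (u x * kernel n c x) @[n --> \oo] --> u c)%R.
Proof.
move=> cu c0; have lu := continuous_locally_integrable cu.
have ck n : continuous (kernel n c) by exact: smooth_continuous.
apply/cvgrPdist_le => e e0.
have uc : {for c, continuous u} by apply: cu; rewrite RposE.
have [d /= d0 ucd] : \forall x \near c, `|u c - u x| <= e.
  by move/cvgrPdist_le : uc; exact.
near=> n.
have nd : n.+1%:R^-1 < d by near: n; exact: near_infty_natSinv_lt (PosNum d0).
rewrite (@Rintegral_supported _ Rpos `[c, (c + n.+1%:R^-1)%R]); first last.
- by move=> x _ /negP; rewrite /= in_itv/= => xD; rewrite kernel_eq0 ?mulr0.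
- exact: subset_itv_Rpos.
have ik : mu.-integrable `[c, (c + n.+1%:R^-1)%R] (EFin \o kernel n c) by exact: continuous_integrable_itv.
have iD : (\int[mu]_(x in `[c, (c + n.+1%:R^-1)%R]) kernel n c x = 1)%R by exact: int_kernel.
have iuk : mu.-integrable `[c, (c + n.+1%:R^-1)%R] (EFin \o (fun x => u x * kernel n c x)).
  apply: integrableS (@integrable_mul_test _ u (kernel n c) c (c + n.+1%:R^-1) lu (ck n) c0 _) => //.
  + exact: measurable_Rpos.
  + exact: subset_itv_Rpos.
  + exact: kernel_eq0.
have icuk : mu.-integrable `[c, (c + n.+1%:R^-1)%R] (EFin \o (fun x => u c * kernel n c x)).
  by apply: continuous_integrable_itv; apply: smooth_continuous; exact: smoothZ.
have -> : u c = (\int[mu]_(x in `[c, (c + n.+1%:R^-1)%R]) (u c * kernel n c x))%R.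
  rewrite (@RintegralZl _ _ _ mu `[c, (c + n.+1%:R^-1)%R] (kernel n c))//.
  by rewrite iD mulr1.
rewrite -RintegralB//.
apply: (le_trans (le_normr_Rintegral _ _)) => //.
  by apply: eq_integrable (integrableB _ icuk iuk).
apply: (@le_trans _ _ (\int[mu]_(x in `[c, (c + n.+1%:R^-1)%R]) (e * kernel n c x))%R); last first.
  by rewrite (@RintegralZl _ _ _ mu `[c, (c + n.+1%:R^-1)%R] (kernel n c))// iD mulr1.
apply: le_Rintegral => //.
- have := integrable_norm (integrableB _ icuk iuk).
  by apply.
- by apply: continuous_integrable_itv; apply: smooth_continuous; exact: smoothZ.
- move=> x; rewrite /= in_itv/= => /andP[cx xc].
  rewrite -mulrBl normrM (ger0_norm (kernel_ge0 _ _ _)).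
  rewrite ler_wpM2r// ucd//=; rewrite ler0_norm ?subr_le0// opprB.
  by apply: le_lt_trans nd; rewrite lerBlDl.
Unshelve. all: by end_near. Qed.

(** The function ramp n a - ramp n b is a test function for every n. It tends
to the indicator function of ]a, b], and its derivative, the difference of the
two kernels, to the difference of the Dirac masses at a and b. *)
Lemma weak_derivative_FTC u v a b : {in Rpos, continuous u} ->
  is_weak_derivative u v -> 0 < a -> a <= b ->
  (u b - u a = \int[mu]_(x in `[a, b]) v x)%R.
Proof.
move=> cu [lu lv uv] a0; rewrite le_eqVlt => /predU1P[<-|ab].
  by rewrite set_itv1 Rintegral_set1 subrr.
have b0 : 0 < b by lra.
pose phi n := ramp n a \- ramp n b.
have sphi n : smooth (phi n) by exact: smoothB.
have phi0 n x : ~~ (a <= x <= b + 1) -> phi n x = 0.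
  rewrite negb_and -!ltNge => /orP[xa|bx].
    by rewrite /phi/= !ramp_eq0 ?subrr//; lra.
  have n1 : n.+1%:R^-1 <= 1 :> R by rewrite invf_le1 ?ler1n ?ltr0n.
  have bn : b + n.+1%:R^-1 <= x by apply: le_trans (ltW bx); rewrite lerD2l.
  rewrite /phi/= !ramp_eq1 ?subrr//; apply: le_trans bn.
  by rewrite lerD2r ltW.
have tphi n : test_function (phi n).
  by apply/test_functionP; split => //; exists a, (b + 1); split => //; [lra|exact: phi0].
have H n : (\int[mu]_(x in Rpos) (u x * kernel n b x) -
            \int[mu]_(x in Rpos) (u x * kernel n a x) =
            \int[mu]_(x in Rpos) (v x * phi n x))%R.
  apply/eqP; rewrite -eqr_opp opprB -uv// -RintegralB//.
  - apply/eqP; apply: eq_Rintegral => x _; rewrite derive1B//.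
    by rewrite !derive1_ramp mulrBr.
  - exact: measurable_Rpos.
  - apply: (@integrable_mul_test _ _ _ a (a + n.+1%:R^-1)) => //.
    + exact: smooth_continuous.
    + exact: kernel_eq0.
  - apply: (@integrable_mul_test _ _ _ b (b + n.+1%:R^-1)) => //.
    + exact: smooth_continuous.
    + exact: kernel_eq0.
have C1 := cvgB (int_kernel_cvg cu b0) (int_kernel_cvg cu a0).
have C2 : (\int[mu]_(x in Rpos) (v x * phi n x) @[n --> \oo] -->
           \int[mu]_(x in `[a, b]) v x)%R.
  pose g x := v x * \1_`]a, b] x.
  have -> : (\int[mu]_(x in `[a, b]) v x = \int[mu]_(x in Rpos) g x)%R.
    rewrite (@Rintegral_supported _ Rpos `]a, b]); first last.
    - by move=> x _ xab; rewrite /g indicE memNset ?mulr0.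
    - by move=> x /= ; rewrite in_itv/= => /andP[ax _]; apply/RposP; lra.
    rewrite -Rintegral_itv_obnd_cbnd.
      by apply: eq_Rintegral => x xab; rewrite /g indicE xab mulr1.
    apply: integrableS (locally_integrable_itv b lv a0) => //.
    by apply: subset_itvr; rewrite bnd_simp.
  have [mv _ _] := lv.
  apply: (@dominated_cvg_Rintegral _ Rpos _ _ (fun x => `|v x| * \1_`[a, (b + 1)%R] x)).
  - exact: measurable_Rpos.
  - move=> n; apply: measurable_funM => //; apply: measurable_funTS.
    by apply: continuous_measurable_fun; exact: smooth_continuous.
  - by apply: measurable_funM => //; apply: measurable_funTS; exact: measurable_indic.
  - move=> x Rx; apply: cvgM; first exact: cvg_cst.
    have -> : \1_`]a, b] x = (a < x)%R%:R - (b < x)%R%:R :> R.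
      rewrite indicE mem_setE in_itv/=.
      by case: ltP => ax; case: leP => bx; rewrite ?subrr ?subr0//; lra.
    by apply: cvgB; exact: ramp_cvg.
  - apply: (@integrable_supported _ _ `[a, (b + 1)%R]) => //.
    + exact: measurable_Rpos.
    + exact: subset_itv_Rpos.
    + by move=> x _ xab; rewrite indicE memNset ?mulr0.
    apply: (@eq_integrable _ _ _ mu _ (measurable_itv _) (abse \o (EFin \o v))) => //.
      by move=> x xab; rewrite /= indicE xab mulr1.
    by apply: integrable_abse; exact: locally_integrable_itv.
  - move=> n x Rx; rewrite normrM ler_wpM2l// indicE mem_setE in_itv/=.
    have [xab|/phi0 ->] := boolP (a <= x <= b + 1); last by rewrite normr0.
    rewrite /phi/= /ramp ler_norml.
    set p := step _; set q := step _.
    have := (step_ge0 (n.+1%:R * x - n.+1%:R * a), step_le1 (n.+1%:R * x - n.+1%:R * a)).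
    have := (step_ge0 (n.+1%:R * x - n.+1%:R * b), step_le1 (n.+1%:R * x - n.+1%:R * b)).
    rewrite -/p -/q => -[q0 q1] [p0 p1]; lra.
move: C2; under eq_fun do rewrite -H; move=> C2.
exact: (cvg_unique _ (C1 _) C2).
Qed.

End weak_derivatives.

(** * Uniqueness and calculus of weak derivatives *)

Section weak_derivative_calculus.
Context {R : realType}.
Notation mu := (@lebesgue_measure R).
Implicit Types (f g u v w phi : R -> R) (a b c t x : R) (n : nat).

(** By Lebesgue's differentiation theorem, w is almost everywhere the
derivative of its integral, which is constant. The theorem asks for an
integrable function, so it is applied to w on [1/(n+1), n+1] for every n. *)
Lemma locally_integrable_ae0 w : locally_integrable Rpos w ->
  (forall a b, 0 < a -> a <= b -> (\int[mu]_(x in `[a, b]) w x = 0)%R) ->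
  {ae mu, forall x, Rpos x -> w x = 0}.
Proof.
move=> lw w0.
pose A n := `[(n.+1%:R^-1 : R), n.+1%:R]%classic.
have A0 n : 0 < n.+1%:R^-1 :> R by rewrite invr_gt0 ltr0n.
pose f n := w \_ (A n).
have wA n : mu.-integrable (A n) (EFin \o w) by exact: locally_integrable_itv.
have fT n : mu.-integrable setT (EFin \o f n).
  rewrite /f -restrict_EFin; have /integrable_mkcond := wA n.
  apply; exact: measurable_itv.
have H n : {ae mu, forall x, n.+1%:R^-1 < x < n.+1%:R -> w x = 0}.
  have fy y : mu.-integrable `]-oo, y] (EFin \o f n) by exact: integrableS (fT n).
  have lf : locally_integrable setT (f n).
    by apply: integrable_locally_restrict; [exact: measurable_itv|exact: wA].
  have [] := FTC1Ny fy lf.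
  move=> N [mN N0 subN]; exists N; split => // x /= Hx; apply: subN => /= dF.
  apply: Hx => /andP[nx xn]; have [_] := dF.
  rewrite {2}/f patchE ifT; last by apply/mem_set; rewrite /A/= in_itv/= !ltW.
  move=> <-.
  rewrite derive1E; apply: derive_val.
  apply: (@near_eq_is_derive _ _ _ (cst 0)).
  near=> y.
  have ny : n.+1%:R^-1 < y by near: y; exact: lt_nbhsr.
  have yn : y < n.+1%:R by near: y; exact: lt_nbhsl.
  rewrite (@Rintegral_supported _ _ `[n.+1%:R^-1, y]); first last.
  - move=> z /=; rewrite in_itv/= => zy /=; rewrite in_itv/= zy andbT => /negP nz.
    by rewrite /f patchE ifF//; apply/negP => /set_mem; rewrite /A/= in_itv/= (negbTE nz).
  - by move=> z /=; rewrite !in_itv/= => /andP[].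
  rewrite -[LHS](w0 _ _ (A0 n) (ltW ny)); apply: eq_Rintegral => z.
  rewrite mem_setE in_itv/= => /andP[nz zy].
  rewrite /f patchE ifT//; apply/mem_set; rewrite /A/= in_itv/= nz/=.
  exact: le_trans zy (ltW yn).
have := ae_foralln H.
apply: filterS => x Hx /RposP x0.
near \oo => n; apply: (Hx n); apply/andP; split.
  by near: n; exact: near_infty_natSinv_lt (PosNum x0).
near: n; exists (Num.truncn x) => // n /= xn.
apply: lt_le_trans (truncnS_gt x) _; rewrite ler_nat ltnS//.
Unshelve. all: by end_near. Qed.

Lemma weak_derivative_ae_unique u v1 v2 : {in Rpos, continuous u} ->
  is_weak_derivative u v1 -> is_weak_derivative u v2 ->
  {ae mu, forall x, Rpos x -> v1 x = v2 x}.
Proof.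
move=> cu wv1 wv2; have [_ l1 _] := wv1; have [_ l2 _] := wv2.
have := @locally_integrable_ae0 (v1 \- v2) (locally_integrableB l1 l2).
have H : forall a b, 0 < a -> a <= b -> (\int[mu]_(x in `[a, b]) (v1 \- v2) x = 0)%R.
  move=> a b a0 ab; rewrite RintegralB//; try exact: locally_integrable_itv.
  rewrite -(weak_derivative_FTC cu wv1 a0 ab).
  by rewrite -(weak_derivative_FTC cu wv2 a0 ab) subrr.
move=> /(_ H)[N [mN N0 subN]]; exists N; split => // x /= nx; apply: subN => /= Hx.
by apply: nx => /Hx /eqP; rewrite subr_eq0 => /eqP.
Qed.

(** This is integration by parts on an interval [a, b] outside of which phi
is 0; by continuity, phi also vanishes at a and b. *)
Lemma smooth_is_weak_derivative f : smooth f -> is_weak_derivative f (derive1 f).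
Proof.
move=> sf; have cf := smooth_continuous sf.
have cf' := smooth_continuous (smooth_derive sf).
have lf : locally_integrable Rpos f by apply: continuous_locally_integrable => x _; exact: cf.
have lf' : locally_integrable Rpos (derive1 f) by apply: continuous_locally_integrable => x _; exact: cf'.
split => // phi /test_functionP[sphi [a [b [a0 ab phi0]]]].
have sub := @subset_itv_Rpos R a b a0.
rewrite (@Rintegral_supported _ Rpos `[a, b])//; last first.
  by move=> x _ /negP; rewrite in_itv => xab; rewrite (derive1_supported phi0)// mulr0.
rewrite [in RHS](@Rintegral_supported _ Rpos `[a, b])//; last first.
  by move=> x _ /negP; rewrite in_itv => xab; rewrite phi0// mulr0.
have pa : phi a = 0.
  have /cvg_at_left_filter H : phi x @[x --> a] --> phi a by exact: smooth_continuous.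
  have := cvg_unique (@Rhausdorff R) H; apply.
  apply: cvg_near_cst; near=> x; apply: phi0; rewrite negb_and -!ltNge; apply/orP; left.
  by near: x; exact: nbhs_left_lt.
have pb : phi b = 0.
  have /cvg_at_right_filter H : phi x @[x --> b] --> phi b by exact: smooth_continuous.
  have := cvg_unique (@Rhausdorff R) H; apply.
  apply: cvg_near_cst; near=> x; apply: phi0; rewrite negb_and -!ltNge; apply/orP; right.
  by near: x; exact: nbhs_right_gt.
have LR g : smooth g -> derivable_oo_LRcontinuous g a b.
  move=> sg; split.
  + by move=> x _; have [] := smooth_is_derive sg x.
  + by apply: cvg_at_right_filter; exact: smooth_continuous.
  + by apply: cvg_at_left_filter; exact: smooth_continuous.
rewrite (@Rintegration_by_parts _ f phi (derive1 f) (derive1 phi))//.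
- by rewrite pa pb !mulr0 subrr sub0r.
- exact: continuous_subspaceT.
- exact: LR.
- by apply: continuous_subspaceT; exact/smooth_continuous/smooth_derive.
- exact: LR.
Unshelve. all: by end_near. Qed.

Lemma is_weak_derivativeB u1 u2 v1 v2 :
  is_weak_derivative u1 v1 -> is_weak_derivative u2 v2 ->
  is_weak_derivative (u1 \- u2) (v1 \- v2).
Proof.
move=> [lu1 lv1 uv1] [lu2 lv2 uv2].
split; [exact: locally_integrableB..|].
move=> phi tphi; have /test_functionP[sphi [a [b [a0 ab phi0]]]] := tphi.
have I f : locally_integrable Rpos f ->
    mu.-integrable Rpos (EFin \o (fun x => f x * phi x)).
  by move=> lf; apply: integrable_mul_test lf (smooth_continuous sphi) a0 phi0.
have I' f : locally_integrable Rpos f ->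
    mu.-integrable Rpos (EFin \o (fun x => f x * derive1 phi x)).
  move=> lf; apply: integrable_mul_test lf _ a0 (derive1_supported phi0).
  exact/smooth_continuous/smooth_derive.
under eq_Rintegral do rewrite /= mulrBl.
under [in RHS]eq_Rintegral do rewrite /= mulrBl.
rewrite (RintegralB measurable_Rpos (I' _ lu1) (I' _ lu2)).
rewrite (RintegralB measurable_Rpos (I _ lv1) (I _ lv2)).
by rewrite uv1// uv2// opprB opprK addrC.
Qed.

Lemma weak_derivativeP u : W11loc R u -> is_weak_derivative u (weak_derivative u).
Proof. by move=> [_ ?]; exact: xgetPex. Qed.

Lemma weak_derivative_ae u v : {in Rpos, continuous u} ->
  is_weak_derivative u v ->
  {ae mu, forall x, Rpos x -> weak_derivative u x = v x}.
Proof.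
move=> cu uv; apply: (weak_derivative_ae_unique cu _ uv).
by apply: weak_derivativeP; split; [exact: cu|exists v; exact: uv].
Qed.

End weak_derivative_calculus.

(** * Integrals of powers *)

Section power_integrals.
Context {R : realType}.
Notation mu := (@lebesgue_measure R).
Implicit Types (a b c g t x : R).

Lemma continuous_powR g x : 0 < x -> {for x, continuous (@powR R ^~ g)}.
Proof.
move=> x0; apply: differentiable_continuous; apply/derivable1_diffP.
by have [] := is_derive1_powR g x0.
Qed.

Lemma within_continuous_powR g a b : 0 < a ->
  {within `[a, b], continuous (@powR R ^~ g)}.
Proof.
move=> a0; apply: continuous_in_subspaceT => x /set_mem/=.
rewrite in_itv/= => /andP[ax _]; apply: continuous_powR; lra.
Qed.

Lemma measurable_powRl g (D : set R) : measurable_fun D (@powR R ^~ g).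
Proof. exact: measurable_funTS (measurable_powR _). Qed.

Lemma integral_powR g a b : g + 1 != 0 -> 0 < a -> a <= b ->
  (\int[mu]_(x in `[a, b]) (x `^ g)%:E =
   ((b `^ (g + 1) - a `^ (g + 1)) / (g + 1))%:E)%E.
Proof.
move=> g1 a0; rewrite le_eqVlt => /predU1P[<-|ab].
  by rewrite set_itv1 integral_set1 subrr mul0r.
pose F x := (g + 1)^-1 * x `^ (g + 1).
have dF x : 0 < x -> is_derive x 1 F (x `^ g).
  move=> x0; have := is_deriveZ (g + 1)^-1 (is_derive1_powR (g + 1) x0).
  by rewrite addrK /GRing.scale/= mulrA mulVf// mul1r.
have cF x : 0 < x -> F x0 @[x0 --> x] --> F x.
  move=> x0; apply: differentiable_continuous; apply/derivable1_diffP.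
  by have [] := dF _ x0.
rewrite (@continuous_FTC2 R _ F)//.
- by rewrite -EFinB /F -mulrBr mulrC.
- exact: within_continuous_powR.
- split.
  + by move=> x; rewrite in_itv/= => /andP[ax _]; have [] := dF x (lt_trans a0 ax).
  + exact: cvg_at_right_filter (cF _ _).
  + by apply: cvg_at_left_filter (cF _ _); exact: lt_trans ab.
- move=> x; rewrite in_itv/= => /andP[ax _]; rewrite derive1E; apply: derive_val.
  exact: dF (lt_trans a0 ax).
Qed.

(** Monotone convergence along the intervals [1/(n+1), t], on which the
integral is explicit. *)
Lemma integral_powR_near0 g t : -1 < g -> 0 < t ->
  (\int[mu]_(x in `]0%R, t]) (x `^ g)%:E <= (t `^ (g + 1) / (g + 1))%:E)%E.
Proof.
move=> g1 t0; have g10 : 0 < g + 1 by lra.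
pose F n := `[(n.+1%:R^-1 : R), t]%classic.
have FE : `]0, t]%classic = \bigcup_n F n.
  apply/seteqP; split=> [x|x [n _]]; rewrite /F/= !in_itv/=.
    move=> /andP[x0 xt]; near \oo => n; exists n => //.
    rewrite /F/= in_itv/= xt andbT ltW//.
    by near: n; exact: near_infty_natSinv_lt (PosNum x0).
  by move=> /andP[nx ->]; rewrite andbT (lt_le_trans _ nx)// invr_gt0 ltr0n.
rewrite FE; apply: cvge_le (ge0_nondecreasing_set_cvg_integral _ _ _ _).
- apply: nearW => n; rewrite /F.
  have [nt|tn] := leP (n.+1%:R^-1) t; last first.
    rewrite set_itv_ge ?bnd_simp -?ltNge// integral_set0 lee_fin.
    by rewrite divr_ge0 ?powR_ge0// ltW.
  rewrite integral_powR ?gt_eqF// ?invr_gt0 ?ltr0n// lee_fin.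
  by rewrite ler_pM2r ?invr_gt0// gerBl powR_ge0.
- apply/nondecreasing_seqP => n; rewrite subsetEset => x; rewrite /F/= !in_itv/=.
  move=> /andP[nx ->]; rewrite andbT; apply: le_trans nx.
  by rewrite lef_pV2 ?posrE ?ltr0n// ler_nat.
- by move=> n; exact: measurable_itv.
- by move=> n; apply/measurable_EFinP; exact: measurable_powRl.
- by move=> n x _; rewrite lee_fin powR_ge0.
Unshelve. all: by end_near. Qed.

Lemma integral_powR_neary g s : g < -1 -> 0 < s ->
  (\int[mu]_(x in `[s, +oo[) (x `^ g)%:E <= (s `^ (g + 1) / - (g + 1))%:E)%E.
Proof.
move=> g1 s0; have g10 : 0 < - (g + 1) by lra.
pose F n := `[s, n%:R]%classic.
have FE : `[s, +oo[%classic = \bigcup_n F n.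
  apply/seteqP; split=> [x|x [n _]]; rewrite /F/= !in_itv/= ?andbT.
    move=> sx; exists (Num.truncn x).+1 => //.
    by rewrite /F/= in_itv/= sx/= ltW// truncnS_gt.
  by move=> /andP[].
rewrite FE; apply: cvge_le (ge0_nondecreasing_set_cvg_integral _ _ _ _).
- apply: nearW => n; rewrite /F.
  have [sn|ns] := leP s n%:R; last first.
    rewrite set_itv_ge ?bnd_simp -?ltNge// integral_set0 lee_fin.
    by rewrite divr_ge0 ?powR_ge0// ltW.
  have g10' : g + 1 < 0 by lra.
  rewrite integral_powR ?lt_eqF// lee_fin invrN mulrN -mulNr.
  by rewrite ler_nM2r ?invr_lt0// lerDr powR_ge0.
- apply/nondecreasing_seqP => n; rewrite subsetEset => x; rewrite /F/= !in_itv/=.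
  by move=> /andP[-> xn]/=; apply: le_trans xn _; rewrite ler_nat.
- by move=> n; exact: measurable_itv.
- by move=> n; apply/measurable_EFinP; exact: measurable_powRl.
- by move=> n x _; rewrite lee_fin powR_ge0.
Qed.

(** It suffices to integrate over ]0, 1], where x^g >= 1/x. The integral of 1/x
over [h, d] is ln (d/h), and h can be chosen to make it exceed any proposed
finite value. *)
Lemma integral_powR_div g e : g <= -1 -> 0 < e ->
  (\int[mu]_(x in `]0%R, e]) (x `^ g)%:E = +oo)%E.
Proof.
move=> g1 e0; pose d := Num.min e 1.
have d0 : 0 < d by rewrite lt_min e0 ltr01.
have de : d <= e by rewrite ge_min lexx.
have d1 : d <= 1 by rewrite ge_min lexx orbT.
have I0 : (0 <= \int[mu]_(x in `]0%R, e]) (x `^ g)%:E)%E.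
  by apply: integral_ge0 => x _; rewrite lee_fin powR_ge0.
apply/eqP; rewrite -leye_eq leNgt; apply/negP => Iy.
set I := (\int[mu]_(_ in _) _)%E in I0 Iy.
have If : I \is a fin_num by rewrite ge0_fin_numE.
pose M := fine I + 1; pose h := d * expR (- M).
have M0 : 0 < M by rewrite ltr_wpDl// fine_ge0.
have h0 : 0 < h by rewrite mulr_gt0// expR_gt0.
have hd : h < d by rewrite -[ltRHS]mulr1 ltr_pM2l// expR_lt1 oppr_lt0.
suff : (M%:E <= I)%E by rewrite -(fineK If) lee_fin; rewrite /M; lra.
have dln x : 0 < x -> is_derive x 1 (@ln R) (x^-1) by move=> x0; exact: is_derive1_ln.
have cln x : 0 < x -> ln x0 @[x0 --> x] --> ln x.
  move=> x0; apply: differentiable_continuous; apply/derivable1_diffP.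
  by have [] := dln _ x0.
have cV : {within `[h, d], continuous (@GRing.inv R)}.
  apply: continuous_in_subspaceT => x /set_mem/=.
  rewrite in_itv/= => /andP[hx _]; apply: inv_continuous.
  by rewrite gt_eqF//; lra.
apply: (@le_trans _ _ (\int[mu]_(x in `[h, d]) (x^-1)%:E)%E).
  rewrite (@continuous_FTC2 R _ (@ln R))//.
  - rewrite -EFinB lee_fin /h lnM ?posrE ?expR_gt0// expRK; lra.
  - split.
    + by move=> x; rewrite in_itv/= => /andP[hx _]; have [] := dln x (lt_trans h0 hx).
    + exact: cvg_at_right_filter (cln _ _).
    + by apply: cvg_at_left_filter (cln _ _).
  - move=> x; rewrite in_itv/= => /andP[ax _]; rewrite derive1E; apply: derive_val.
    exact: dln (lt_trans h0 ax).
apply: (@le_trans _ _ (\int[mu]_(x in `[h, d]) (x `^ g)%:E)%E).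
  apply: ge0_le_integral => //.
  - by move=> x; rewrite /= in_itv/= => /andP[hx _]; rewrite lee_fin invr_ge0; lra.
  - apply/measurable_EFinP; exact: subspace_continuous_measurable_fun.
  - by apply/measurable_EFinP; exact: measurable_powRl.
  - move=> x; rewrite /= in_itv/= => /andP[hx xd]; rewrite lee_fin.
    have x0 : 0 < x by lra.
    rewrite -powR_inv1 ?(ltW x0)//; apply: ger_powR => //.
    by rewrite x0; apply: le_trans d1.
apply: ge0_subset_integral => //.
- by apply/measurable_EFinP; exact: measurable_powRl.
- by move=> x _; rewrite lee_fin powR_ge0.
- by apply: subset_itv; rewrite bnd_simp.
Qed.

End power_integrals.

(** * Hardy's inequality *)

Section hardy.
Context {R : realType}.
Notation mu := (@lebesgue_measure R).
Implicit Types (v : R -> R) (a b c g t x : R).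

Lemma measurable_normr_powR (D : set R) v c :
  measurable_fun D v -> measurable_fun D (fun x => `|v x| `^ c).
Proof.
move=> mv; apply: (@measurableT_comp _ _ _ _ _ _ (@powR R ^~ c) _ (fun x => `|v x|)).
  exact: measurable_powR.
exact: measurableT_comp.
Qed.

Lemma measurable_weighted (D : set R) v c g : measurable_fun D v ->
  measurable_fun D (fun x => (`|v x| `^ c * x `^ g)%:E).
Proof.
move=> mv; apply/measurable_EFinP; apply: measurable_funM.
  exact: measurable_normr_powR.
exact: measurable_powRl.
Qed.

Lemma subset_oc_Rpos t : `]0, t] `<=` @Rpos R.
Proof. by move=> x /=; rewrite in_itv/= => /andP[x0 _]; exact/RposP. Qed.

(** Hölder's inequality for |v| = (|v| x^(g/p)) x^(-g/p). The power of the
second factor that has to be integrated is x^(-g/(p-1)), which is integrable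
at 0 because g < p - 1. *)
Lemma weighted_hoelder p g : 1 < p -> g < p - 1 ->
  exists2 C : R, 0 < C & forall v t, measurable_fun Rpos v -> 0 < t ->
  ((\int[mu]_(x in `]0%R, t]) `|v x|%:E) `^ p <=
   (C * t `^ (p - 1 - g))%:E *
   \int[mu]_(x in `]0%R, t]) (`|v x| `^ p * x `^ g)%:E)%E.
Proof.
move=> p1 gp; have p0 : 0 < p by lra.
have pm0 : 0 < p - 1 by lra.
pose q := p / (p - 1); have q0 : 0 < q by rewrite divr_gt0.
pose s := - g / (p - 1).
have s1 : -1 < s by rewrite ltr_pdivlMr// mulN1r; lra.
have s10 : 0 < s + 1 by lra.
exists ((s + 1)^-1 `^ (p - 1)); first by rewrite powR_gt0// invr_gt0.
move=> v t mv t0.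
have mI : measurable (`]0, t]%classic : set (measurableTypeR R)) by exact: measurable_itv.
pose f0 x := `|v x| * x `^ (g / p).
pose h0 x := x `^ (- (g / p)).
have mvI : measurable_fun `]0, t] v.
  by apply: measurable_funS mv; [exact: measurable_Rpos|exact: subset_oc_Rpos].
pose f := f0 \_ `]0, t]; pose h := h0 \_ `]0, t].
have mf : measurable_fun setT f.
  apply/(measurable_restrictT _ _).1 => //; apply: measurable_funM.
    exact: measurableT_comp.
  exact: measurable_powRl.
have mh : measurable_fun setT h.
  by apply/(measurable_restrictT _ _).1 => //; exact: measurable_powRl.
have pq : p^-1 + q^-1 = 1.
  rewrite /q invf_div -{1}[p^-1]mul1r -mulrDl addrC subrK divff// gt_eqF//.
have := hoelder mu mf mh p0 q0 pq.
have xp x : `]0, t]%classic x -> 0 < x by rewrite /= in_itv/= => /andP[].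
rewrite Lnorm1.
have -> : (\int[mu]_x `|(EFin \o (f \* h)%R) x| = \int[mu]_(x in `]0%R, t]) `|v x|%:E)%E.
  rewrite (@integral_supported _ setT `]0, t])//; last first.
    by move=> x _ xI; rewrite /= /f patchE memNset// mul0r normr0.
  apply: eq_integral => x xI; have x0 := xp _ (set_mem xI).
  rewrite /= /f /h !patchE xI /f0 /h0 -mulrA -powRD ?subrr; last first.
    by rewrite (gt_eqF x0) implybT.
  by rewrite powRr0 mulr1 normr_id.
move=> H.
have {}H := gt0_ler_poweR (ltW p0) _ _ H.
apply: le_trans; first apply: H.
- by rewrite in_itv/= leey andbT integral_ge0// => x _; rewrite lee_fin.
- by rewrite in_itv/= leey andbT mule_ge0// Lnorm_ge0.
rewrite poweRM ?Lnorm_ge0// poweR_Lnorm ?gt_eqF//.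
have -> : (\int[mu]_x (`|(EFin \o f) x| `^ p) =
    \int[mu]_(x in `]0%R, t]) (`|v x| `^ p * x `^ g)%:E)%E.
  rewrite (@integral_supported _ setT `]0, t])//; last first.
    by move=> x _ xI; rewrite /= /f patchE memNset// normr0 powR0// gt_eqF.
  apply: eq_integral => x xI; have x0 := xp _ (set_mem xI).
  rewrite /= /f patchE xI /f0 ger0_norm ?mulr_ge0 ?powR_ge0//.
  by rewrite powRM ?powR_ge0// -powRrM -mulrA mulVf ?mulr1// gt_eqF.
have -> : p = q * (p - 1) by rewrite /q -mulrA mulVf ?mulr1// gt_eqF.
rewrite poweRrM poweR_Lnorm ?gt_eqF//.
rewrite muleC lee_wpmul2r ?integral_ge0//.
  by move=> x _; rewrite lee_fin mulr_ge0 ?powR_ge0.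
have -> : (\int[mu]_x (`|(EFin \o h) x| `^ q) = \int[mu]_(x in `]0%R, t]) (x `^ s)%:E)%E.
  rewrite (@integral_supported _ setT `]0, t]); [|by []|]; last first.
    by move=> x _ xI; rewrite /= /h patchE memNset// normr0 powR0// gt_eqF.
  apply: eq_integral => x xI; have x0 := xp _ (set_mem xI).
  rewrite /= /h patchE xI /h0 ger0_norm ?powR_ge0//.
  rewrite -powRrM /q /s; congr (_ `^ _)%:E.
  by field; rewrite !gt_eqF.
have := integral_powR_near0 s1 t0 => K.
apply: le_trans (gt0_ler_poweR (ltW pm0) _ _ K) _.
- by rewrite in_itv/= leey andbT integral_ge0// => x _; rewrite lee_fin powR_ge0.
- by rewrite in_itv/= leey andbT lee_fin divr_ge0 ?powR_ge0// ltW.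
rewrite poweR_EFin lee_fin powRM ?powR_ge0 ?invr_ge0 ?(ltW s10)//.
have -> : q * (p - 1) = p by rewrite /q -mulrA mulVf ?mulr1// gt_eqF.
rewrite mulrC ler_wpM2l ?powR_ge0// -powRrM le_eqVlt; apply/orP; left; apply/eqP.
by congr (_ `^ _); rewrite /s; field; rewrite gt_eqF.
Qed.

Section triangle.
Variables (w k : R -> R).
Hypotheses (w0 : forall x, 0 < x -> 0 <= w x) (k0 : forall x, 0 < x -> 0 <= k x).
Hypotheses (mw : measurable_fun Rpos w) (mk : measurable_fun Rpos k).

(* The integrand w t * k x on the triangle 0 < x <= t, extended by 0. *)
Let w' := w \_ Rpos.
Let k' := k \_ Rpos.
Let F (z : measurableTypeR R * measurableTypeR R) : \bar R :=
  (w' z.1 * k' z.2 * (z.2 <= z.1)%R%:R)%:E.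

Let restrictE (f : R -> R) x : 0 < x -> (f \_ Rpos) x = f x.
Proof. by move=> x0; rewrite patchE ifT// RposE. Qed.

Let restrictN (f : R -> R) x : ~ Rpos x -> (f \_ Rpos) x = 0.
Proof. by move=> x0; rewrite patchE memNset. Qed.

Let restrict_ge0 (f : R -> R) x : (forall x, 0 < x -> 0 <= f x) ->
  0 <= (f \_ Rpos) x.
Proof. by move=> f0; rewrite patchE; case: ifPn => // /set_mem /RposP /f0. Qed.

Let mF : measurable_fun setT F.
Proof.
have mr (f : R -> R) : measurable_fun Rpos f -> measurable_fun setT (f \_ Rpos).
  by move=> mf; apply/(measurable_restrictT _ _).1; first exact: measurable_Rpos.
apply/measurable_EFinP; apply: measurable_funM; first apply: measurable_funM.
- by apply: measurableT_comp (mr _ mw) _; exact: measurable_fst.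
- by apply: measurableT_comp (mr _ mk) _; exact: measurable_snd.
- apply: (@measurableT_comp _ _ _ _ _ _ (fun z : bool => z%:R : R)) => //.
  by apply: measurable_fun_ler; [exact: measurable_snd|exact: measurable_fst].
Qed.

Let F0 z : (0 <= F z)%E.
Proof. by rewrite lee_fin mulr_ge0// mulr_ge0// restrict_ge0. Qed.

Let F1 t : 0 < t -> (\int[mu]_x F (t, x) =
    (w t)%:E * \int[mu]_(x in `]0%R, t]) (k x)%:E)%E.
Proof.
move=> t0; rewrite (@integral_supported _ setT `]0, t])//; last first.
  move=> x _ /negP; rewrite /F /= in_itv/= negb_and -leNgt -ltNge => /orP[x0|tx].
    by rewrite [k' x]restrictN ?mulr0 ?mul0r// => /RposP; rewrite ltNge x0.
  by rewrite leNgt tx mulr0.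
rewrite -ge0_integralZl//.
- apply: eq_integral => x; rewrite inE/= in_itv/= => /andP[x0 xt].
  by rewrite /F/= xt mulr1 [w' t]restrictE// [k' x]restrictE.
- apply/measurable_EFinP; apply: measurable_funS mk.
    exact: measurable_Rpos.
  exact: subset_oc_Rpos.
- by move=> x; rewrite /= in_itv/= => /andP[x0 _]; rewrite lee_fin k0.
- by rewrite lee_fin w0.
Qed.

Let F2 x : 0 < x -> (\int[mu]_t F (t, x) =
    (k x)%:E * \int[mu]_(t in `[x, +oo[) (w t)%:E)%E.
Proof.
move=> x0; rewrite (@integral_supported _ setT `[x, +oo[)//; last first.
  by move=> t _ /negP; rewrite /F /= in_itv/= andbT => /negbTE ->; rewrite mulr0.
rewrite -ge0_integralZl//.
- apply: eq_integral => t; rewrite inE/= in_itv/= andbT => xt.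
  have t0 := lt_le_trans x0 xt.
  by rewrite /F/= xt mulr1 [w' t]restrictE// [k' x]restrictE// mulrC.
- apply/measurable_EFinP; apply: measurable_funS mw.
    exact: measurable_Rpos.
  by move=> t /=; rewrite in_itv/= andbT => xt; apply/RposP; exact: lt_le_trans xt.
- by move=> t; rewrite /= in_itv/= andbT => xt; rewrite lee_fin w0//; exact: lt_le_trans xt.
- by rewrite lee_fin k0.
Qed.

Lemma triangle_tonelli :
  (\int[mu]_(t in Rpos) ((w t)%:E * \int[mu]_(x in `]0%R, t]) (k x)%:E) =
   \int[mu]_(x in Rpos) ((k x)%:E * \int[mu]_(t in `[x, +oo[) (w t)%:E))%E.
Proof.
transitivity (\int[mu]_t \int[mu]_x F (t, x))%E.
  rewrite [RHS](@integral_supported _ setT Rpos)//; last first.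
    move=> t _ t0; under eq_integral do rewrite /F/= [w' t]restrictN// !mul0r.
    exact: integral0.
  by apply: eq_integral => t; rewrite RposE => t0; rewrite F1.
rewrite (@fubini_tonelli _ _ _ _ R mu mu F mF F0).
rewrite (@integral_supported _ setT Rpos)//; last first.
  move=> x _ x0; under eq_integral do rewrite /F/= [k' x]restrictN// mulr0 mul0r.
  exact: integral0.
by apply: eq_integral => x; rewrite RposE => x0; rewrite F2.
Qed.

Lemma measurable_triangle_l :
  measurable_fun Rpos (fun t => (w t)%:E * \int[mu]_(x in `]0%R, t]) (k x)%:E)%E.
Proof.
have := @measurable_fun_fubini_tonelli_F _ _ _ _ R mu F mF F0.
move=> /(measurable_funS measurableT (@subsetT _ Rpos)).
apply: eq_measurable_fun => t; rewrite RposE => t0.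
by rewrite -F1.
Qed.

Lemma measurable_triangle_r :
  measurable_fun Rpos (fun x => (k x)%:E * \int[mu]_(t in `[x, +oo[) (w t)%:E)%E.
Proof.
have := @measurable_fun_fubini_tonelli_G _ _ _ _ R mu F mF F0.
move=> /(measurable_funS measurableT (@subsetT _ Rpos)).
apply: eq_measurable_fun => t; rewrite RposE => t0.
by rewrite -F2.
Qed.

End triangle.

(** Apply the weighted Hölder inequality with an exponent g strictly between b
and p - 1. It bounds |u t|^p t^(b-p) by a constant times
t^(b-1-g) int_0^t |v|^p x^g dx, and after an exchange of the integrals there
remains the integral of t^(b-1-g) over [x, +oo[, which is x^(b-g)/(g-b)
because b < g. *)
Lemma hardy p b : 1 < p -> b < p - 1 ->
  exists2 C : R, 0 < C & forall u v : R -> R, measurable_fun Rpos u ->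
  measurable_fun Rpos v ->
  (forall t, 0 < t -> (`|u t|%:E <= \int[mu]_(x in `]0%R, t]) `|v x|%:E)%E) ->
  (\int[mu]_(t in Rpos) (`|u t| `^ p * t `^ (b - p))%:E <=
   C%:E * \int[mu]_(x in Rpos) (`|v x| `^ p * x `^ b)%:E)%E.
Proof.
move=> p1 bp; pose g := (b + (p - 1)) / 2.
have p0 : 0 < p by lra.
have bg : b < g by rewrite /g; lra.
have gp : g < p - 1 by rewrite /g; lra.
have [C C0 CH] := weighted_hoelder p1 gp.
exists (C / (g - b)); first by rewrite divr_gt0// subr_gt0.
move=> u v mu_ mv uv.
pose k x := `|v x| `^ p * x `^ g.
have k0 x : 0 <= k x by rewrite mulr_ge0 ?powR_ge0.
have mk : measurable_fun Rpos k.
  by apply: measurable_funM; [exact: measurable_normr_powR|exact: measurable_powRl].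
pose w t := t `^ (b - 1 - g).
have w0 t : 0 <= w t by rewrite powR_ge0.
have mw : measurable_fun Rpos w by exact: measurable_powRl.
have Tri := triangle_tonelli (fun x _ => w0 x) (fun x _ => k0 x) mw mk.
have ml := measurable_triangle_l (fun x _ => w0 x) (fun x _ => k0 x) mw mk.
have mr := measurable_triangle_r (fun x _ => w0 x) (fun x _ => k0 x) mw mk.
apply: (@le_trans _ _ (C%:E * \int[mu]_(t in Rpos)
    ((w t)%:E * \int[mu]_(x in `]0%R, t]) (k x)%:E))%E).
  have K0 t : Rpos t -> (0 <= (w t)%:E * \int[mu]_(x in `]0%R, t]) (k x)%:E)%E.
    move=> _; rewrite mule_ge0 ?lee_fin// integral_ge0// => x _.
    by rewrite lee_fin.
  rewrite -(@ge0_integralZl _ _ _ mu _ measurable_Rpos _ ml C%:E K0); last by rewrite lee_fin ltW.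
  apply: ge0_le_integral.
  - exact: measurable_Rpos.
  - by move=> t _; rewrite lee_fin mulr_ge0 ?powR_ge0.
  - exact: measurable_weighted.
  - exact: measurable_funeM.
  - move=> t /RposP t0.
    have K := gt0_ler_poweR (ltW p0) _ _ (uv _ t0).
    rewrite EFinM muleC.
    apply: (@le_trans _ _ ((t `^ (b - p))%:E * ((C * t `^ (p - 1 - g))%:E *
      \int[mu]_(x in `]0%R, t]) (k x)%:E))%E).
      rewrite lee_wpmul2l ?lee_fin ?powR_ge0//; apply: le_trans (CH _ _ mv t0).
      apply: K.
      + by rewrite in_itv/= leey andbT lee_fin.
      + by rewrite in_itv/= leey andbT integral_ge0// => x _; rewrite lee_fin.
    rewrite !muleA -!EFinM le_eqVlt; apply/orP; left; apply/eqP; congr (_%:E * _)%E.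
    rewrite mulrCA -powRD; last by rewrite (gt_eqF t0) implybT.
    by congr (_ * _ `^ _); ring.
rewrite Tri EFinM -muleA lee_wpmul2l ?lee_fin ?(ltW C0)//.
rewrite -(@ge0_integralZl _ _ _ mu _ measurable_Rpos); first last.
- by rewrite lee_fin invr_ge0 subr_ge0 ltW.
- by move=> x _; rewrite lee_fin mulr_ge0 ?powR_ge0.
- exact: measurable_weighted.
apply: ge0_le_integral.
- exact: measurable_Rpos.
- move=> x _; rewrite mule_ge0 ?lee_fin// integral_ge0// => t _.
  by rewrite lee_fin.
- exact: mr.
- by apply: measurable_funeM; exact: measurable_weighted.
- move=> x /RposP x0.
  have s1 : b - 1 - g < -1 by lra.
  have K := integral_powR_neary s1 x0.
  apply: (@le_trans _ _ ((k x)%:E * (x `^ (b - 1 - g + 1) / - (b - 1 - g + 1))%:E)%E).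
    by rewrite lee_wpmul2l ?lee_fin.
  rewrite -!EFinM lee_fin le_eqVlt; apply/orP; left; apply/eqP.
  rewrite /k -mulrA (mulrCA (x `^ g)) [RHS]mulrCA; congr (_ * _).
  rewrite mulrA -powRD; last by rewrite (gt_eqF x0) implybT.
  by rewrite mulrC; congr (_^-1 * _ `^ _); ring.
Qed.

End hardy.

(** * The trace at the origin *)

Section trace.
Context {R : realType}.
Notation mu := (@lebesgue_measure R).
Variables (p beta : R).
Hypotheses (p1 : 1 < p) (betap : beta < p - 1).
Implicit Types (u v f : R -> R) (a b c g t x L : R).

Let p0 : 0 < p. Proof. exact: lt_trans ltr01 p1. Qed.

(** The p-th powers of the weighted norms are easier to handle than the norms:
they depend monotonically on the domain, and inequalities between integrands
apply to them without taking roots. *)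
Definition energy_on (D : set R) g f := (\int[mu]_(t in D) (`|f t| `^ p * t `^ g)%:E)%E.

Definition energy g f := energy_on Rpos g f.

Lemma energy_ge0 g f : (0 <= energy g f)%E.
Proof. by apply: integral_ge0 => x _; rewrite lee_fin mulr_ge0 ?powR_ge0. Qed.

Lemma integrable_energy g f : measurable_fun Rpos f -> (energy g f < +oo)%E ->
  mu.-integrable Rpos (EFin \o (fun t => `|f t| `^ p * t `^ g)).
Proof.
move=> mf fy; apply/integrableP; split; first exact: measurable_weighted.
apply: le_lt_trans fy; rewrite le_eqVlt; apply/orP; left; apply/eqP.
by apply: eq_integral => x _ /=; rewrite ger0_norm// mulr_ge0 ?powR_ge0.
Qed.

Lemma continuous_Rpos_measurable u : {in Rpos, continuous u} -> measurable_fun Rpos u.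
Proof. by move=> /continuous_locally_integrable[]. Qed.

Lemma finite_energy_integrable v t : measurable_fun Rpos v ->
  (energy beta v < +oo)%E -> 0 < t -> mu.-integrable `]0, t] (EFin \o v).
Proof.
move=> mv Iv t0; have [C C0 CH] := weighted_hoelder p1 betap.
have mvt : measurable_fun `]0, t] v.
  by apply: measurable_funS mv; [exact: measurable_Rpos|exact: subset_oc_Rpos].
apply/integrableP; split; first by apply/measurable_EFinP; exact: mvt.
apply: (@lty_poweRy _ _ p); first by rewrite (gt_eqF p0).
apply: le_lt_trans (CH _ _ mv t0) _.
rewrite lte_mul_pinfty ?lee_fin ?mulr_ge0 ?powR_ge0 ?(ltW C0)//.
apply: le_lt_trans Iv; apply: ge0_subset_integral => //.
- exact: measurable_Rpos.
- exact: measurable_weighted.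
- by move=> x _; rewrite lee_fin mulr_ge0 ?powR_ge0.
- exact: subset_oc_Rpos.
Qed.

(** By the fundamental theorem of calculus, u t - int_0^t v does not depend on
t; its value is the limit L. The integral up to 0 makes sense because v is
integrable there. *)
Lemma trace_exists u v : {in Rpos, continuous u} -> is_weak_derivative u v ->
  (energy beta v < +oo)%E ->
  exists L, forall t, 0 < t -> (`|u t - L|%:E <= \int[mu]_(x in `]0%R, t]) `|v x|%:E)%E.
Proof.
move=> cu uv Iv; have [_ [mv _ _] _] := uv.
have iv t : 0 < t -> mu.-integrable `]0, t] (EFin \o v) by exact: finite_energy_integrable.
have D s t : 0 < s -> s <= t ->
    (\int[mu]_(x in `]0%R, t]) v x - \int[mu]_(x in `]0%R, s]) v x = u t - u s)%R.
  move=> s0 st; have t0 := lt_le_trans s0 st.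
  rewrite (Rintegral_itvB (iv _ t0)) ?bnd_simp ?(ltW s0)//.
  rewrite Rintegral_itv_obnd_cbnd; first by rewrite (weak_derivative_FTC cu uv).
  by apply: integrableS (iv _ t0) => //; apply: subset_itvr; rewrite bnd_simp ltW.
exists (u 1 - \int[mu]_(x in `]0%R, 1]) v x)%R => t t0.
have -> : (u t - (u 1 - \int[mu]_(x in `]0%R, 1]) v x) = \int[mu]_(x in `]0%R, t]) v x)%R.
  have [t1|/ltW t1] := leP t 1.
    by have := D _ _ t0 t1; lra.
  by have := D _ _ ltr01 t1; lra.
rewrite EFin_normr_Rintegral//; last exact: iv.
by apply: le_abse_integral => //; case/integrableP : (iv _ t0).
Qed.

Lemma trace_bound : exists2 C, 0 < C &
  forall u v L t, measurable_fun Rpos v -> 0 < t ->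
  (`|u t - L|%:E <= \int[mu]_(x in `]0%R, t]) `|v x|%:E)%E ->
  ((`|u t - L| `^ p)%:E <= (C * t `^ (p - 1 - beta))%:E *
     \int[mu]_(x in `]0%R, t]) (`|v x| `^ p * x `^ beta)%:E)%E.
Proof.
have [C C0 CH] := weighted_hoelder p1 betap; exists C => // u v L t mv t0 uL.
apply: le_trans (CH _ _ mv t0).
rewrite -poweR_EFin; apply: (gt0_ler_poweR (ltW p0) _ _ uL).
- by rewrite in_itv/= leey andbT lee_fin.
- by rewrite in_itv/= leey andbT integral_ge0// => x _; rewrite lee_fin.
Qed.

Lemma energy_near0 v : measurable_fun Rpos v -> (energy beta v < +oo)%E ->
  (\int[mu]_(x in `]0%R, t]) (`|v x| `^ p * x `^ beta))%R @[t --> 0^'+] --> (0 : R).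
Proof.
move=> mv Iv; pose f := (fun x => `|v x| `^ p * x `^ beta) \_ Rpos.
have fi : mu.-integrable `[0, 1] (EFin \o f).
  apply: (@integrableS _ _ _ _ setT) => //.
  rewrite /f -restrict_EFin; have /integrable_mkcond := integrable_energy mv Iv.
  by apply; exact: measurable_Rpos.
have := parameterized_integral_cvg_left ltr01 fi.
move=> /cvg_at_right_filter; apply: cvg_trans; apply: near_eq_cvg.
near=> t; have t0 : 0 < t by near: t; exact: nbhs_right_gt.
rewrite /parameterized_integral (@Rintegral_supported _ `[0, t] `]0, t]).
- apply: eq_Rintegral => x; rewrite inE/= in_itv/= => /andP[x0 xt].
  by rewrite /f patchE ifT// RposE.
- by apply: subset_itvr; rewrite bnd_simp.
- move=> x /=; rewrite !in_itv/= => /andP[x0 ->]; rewrite andbT => /negP.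
  rewrite -leNgt => x0'; rewrite /f patchE memNset// => /RposP; lra.
Unshelve. all: by end_near. Qed.

Lemma trace_weighted_cvg u v L : measurable_fun Rpos v -> (energy beta v < +oo)%E ->
  (forall t, 0 < t -> (`|u t - L|%:E <= \int[mu]_(x in `]0%R, t]) `|v x|%:E)%E) ->
  t `^ ((beta - (p - 1)) / p) * `|u t - L| @[t --> 0^'+] --> (0 : R).
Proof.
move=> mv Iv uL; have [C C0 CH] := trace_bound.
apply/cvgrPdist_le => e e0.
have ep0 : 0 < e `^ p / C by rewrite divr_gt0// powR_gt0.
have /cvgrPdist_le /(_ _ ep0) J0 := energy_near0 mv Iv.
near=> t; have t0 : 0 < t by near: t; exact: nbhs_right_gt.
have It : mu.-integrable `]0, t] (EFin \o (fun x => `|v x| `^ p * x `^ beta)).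
  apply: integrableS (integrable_energy mv Iv) => //; first exact: measurable_Rpos.
  exact: subset_oc_Rpos.
have Jt : (\int[mu]_(x in `]0%R, t]) (`|v x| `^ p * x `^ beta))%R <= e `^ p / C.
  have : `|0 - (\int[mu]_(x in `]0%R, t]) (`|v x| `^ p * x `^ beta))%R| <= e `^ p / C.
    by near: t; exact: J0.
  rewrite sub0r normrN ger0_norm//.
  by apply: Rintegral_ge0 => x _; rewrite mulr_ge0 ?powR_ge0.
rewrite sub0r normrN ger0_norm ?mulr_ge0 ?powR_ge0//.
have := CH _ _ _ _ mv t0 (uL _ t0).
rewrite -[X in (_ <= _ * X)%E]fineK; last exact: integrable_fin_num.
rewrite -EFinM lee_fin -/(Rintegral _ _ _) => K.
rewrite leNgt; apply/negP => lt_e.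
have : e `^ p < (t `^ ((beta - (p - 1)) / p) * `|u t - L|) `^ p.
  by apply: gt0_ltr_powR; rewrite ?nnegrE ?mulr_ge0 ?powR_ge0// ltW.
rewrite powRM ?powR_ge0// -powRrM mulfVK ?gt_eqF// ltNge => /negP; apply.
apply: (@le_trans _ _ (t `^ (beta - (p - 1)) * (C * t `^ (p - 1 - beta) * (e `^ p / C)))).
  rewrite ler_wpM2l ?powR_ge0//; apply: le_trans K _.
  by rewrite ler_wpM2l// mulr_ge0 ?powR_ge0 ?ltW.
rewrite (_ : p - 1 - beta = - (beta - (p - 1))); last by ring.
have T0 : t `^ (beta - (p - 1)) != 0 by rewrite gt_eqF// powR_gt0.
rewrite powRN le_eqVlt; apply/orP; left; apply/eqP.
by field; rewrite T0 gt_eqF.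
Unshelve. all: by end_near. Qed.

(** The weight tends to infinity at 0 because beta < p - 1. *)
Lemma weighted_cvg_cvg u L :
  t `^ ((beta - (p - 1)) / p) * `|u t - L| @[t --> 0^'+] --> (0 : R) ->
  u t @[t --> 0^'+] --> L.
Proof.
move=> H; have e0 : 0 < (p - 1 - beta) / p.
  by rewrite divr_gt0//; move: betap; lra.
have H2 : t `^ ((beta - (p - 1)) / p) * `|u t - L| * t `^ ((p - 1 - beta) / p)
    @[t --> 0^'+] --> (0 : R).
  by rewrite -[X in _ --> X](mul0r 0); apply: cvgM H (powR_cvg0 e0).
apply/subr_cvg0/norm_cvg0P; apply: cvg_trans H2; apply: near_eq_cvg; near=> t.
have t0 : 0 < t by near: t; exact: nbhs_right_gt.
rewrite /= mulrAC -powRD; last by rewrite (gt_eqF t0) implybT.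
by rewrite -mulrDl (_ : _ + _ = 0) ?mul0r ?powRr0 ?mul1r//; ring.
Unshelve. all: by end_near. Qed.

Lemma trace_cvg u v L : measurable_fun Rpos v -> (energy beta v < +oo)%E ->
  (forall t, 0 < t -> (`|u t - L|%:E <= \int[mu]_(x in `]0%R, t]) `|v x|%:E)%E) ->
  u t @[t --> 0^'+] --> L.
Proof. by move=> mv Iv uL; apply: weighted_cvg_cvg; exact: trace_weighted_cvg uL. Qed.

(** Near 0, |u| is at least |L|/2, and x^g is not integrable. *)
Lemma energy_div u g L : measurable_fun Rpos u -> g <= -1 ->
  u t @[t --> 0^'+] --> L -> L != 0 -> energy g u = +oo%E.
Proof.
move=> mu_ g1 uL L0; have L0' : 0 < `|L| / 2 by rewrite divr_gt0// normr_gt0.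
have /cvgrPdist_lt /(_ _ L0') [e /= e0 eL] := uL.
have e20 : 0 < e / 2 by lra.
apply/eqP; rewrite -leye_eq.
have c0 : 0 < (`|L| / 2) `^ p by rewrite powR_gt0.
have <- : (((`|L| / 2) `^ p)%:E * \int[mu]_(x in `]0%R, (e / 2)%R]) (x `^ g)%:E = +oo)%E.
  by rewrite integral_powR_div// gt0_muley// lte_fin.
rewrite -(@ge0_integralZl _ _ _ mu _ (measurable_itv _)); first last.
- by rewrite lee_fin ltW.
- by move=> x _; rewrite lee_fin powR_ge0.
- by apply/measurable_EFinP; exact: measurable_powRl.
apply: (@le_trans _ _ (\int[mu]_(x in `]0%R, (e / 2)%R]) (`|u x| `^ p * x `^ g)%:E)%E).
  apply: ge0_le_integral => //.
  - by move=> x _; rewrite lee_fin mulr_ge0 ?powR_ge0.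
  - by apply: measurable_funeM; apply/measurable_EFinP; exact: measurable_powRl.
  - apply: measurable_weighted; apply: measurable_funS mu_; first exact: measurable_Rpos.
    exact: subset_oc_Rpos.
  - move=> x; rewrite /= in_itv/= => /andP[x0 xe].
    rewrite lee_fin ler_wpM2r ?powR_ge0// ge0_ler_powR ?nnegrE ?(ltW p0) ?(ltW L0')//.
    have := eL x; rewrite /= sub0r normrN gtr0_norm// => /(_ _ x0) H.
    have {}H : `|L - u x| < `|L| / 2 by apply: H; lra.
    have := ler_normB (L - u x) (- u x); rewrite opprK subrK normrN; lra.
apply: ge0_subset_integral => //.
- exact: measurable_Rpos.
- exact: measurable_weighted.
- by move=> x _; rewrite lee_fin mulr_ge0 ?powR_ge0.
- exact: subset_oc_Rpos.
Qed.

End trace.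

(** * The norm of the weighted Sobolev space *)

Section norms.
Context {R : realType}.
Notation mu := (@lebesgue_measure R).
Variables (p beta : R).
Hypothesis p1 : 1 < p.
Implicit Types (u v f : R -> R) (a b c g t x L : R).

Let p0 : 0 < p. Proof. exact: lt_trans ltr01 p1. Qed.

Lemma weighted_Lp_ge0 (w f : R -> R) : (0 <= weighted_Lp p w f)%E.
Proof. exact: poweR_ge0. Qed.

Lemma weighted_Lp_lty (w f : R -> R) : (weighted_Lp p w f < +oo)%E <->
  (\int[mu]_(t in Rpos) (`|f t| `^ p * w t)%:E < +oo)%E.
Proof.
split; first by apply: lty_poweRy; rewrite invr_neq0// gt_eqF.
exact: poweR_lty.
Qed.

Lemma adde_lty (x y : \bar R) : (0 <= x)%E -> (0 <= y)%E ->
  (x + y < +oo)%E <-> (x < +oo)%E /\ (y < +oo)%E.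
Proof.
move=> x0 y0; split=> [xy|[xy yy]]; last exact: lte_add_pinfty.
by split; apply: le_lt_trans xy; rewrite ?leeDl ?leeDr.
Qed.

Lemma W1p_normP u : (W1p_norm p beta u < +oo)%E <->
  (energy p beta u < +oo)%E /\ (energy p beta (weak_derivative u) < +oo)%E.
Proof.
have H := adde_lty (weighted_Lp_ge0 (fun t => t `^ beta) u)
  (weighted_Lp_ge0 (fun t => t `^ beta) (weak_derivative u)).
split=> [K|[A B]].
  have [A B] := proj1 H K; split.
    exact (proj1 (weighted_Lp_lty (fun t => t `^ beta) u) A).
  exact (proj1 (weighted_Lp_lty (fun t => t `^ beta) (weak_derivative u)) B).
apply: (proj2 H); split.
  exact (proj2 (weighted_Lp_lty (fun t => t `^ beta) u) A).
exact (proj2 (weighted_Lp_lty (fun t => t `^ beta) (weak_derivative u)) B).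
Qed.

Lemma W1p_norm_lt u e : 0 < e -> (W1p_norm p beta u < e%:E)%E ->
  (energy p beta u <= (e `^ p)%:E)%E /\
  (energy p beta (weak_derivative u) <= (e `^ p)%:E)%E.
Proof.
move=> e0 ue.
have H f : (weighted_Lp p (fun t => t `^ beta)%R f <= e%:E)%E ->
    (energy p beta f <= (e `^ p)%:E)%E.
  move=> K; have := gt0_ler_poweR (ltW p0) _ _ K.
  rewrite /weighted_Lp -poweRrM mulVf ?gt_eqF// poweRe1; last exact: energy_ge0.
  apply; first by rewrite in_itv/= leey andbT poweR_ge0.
  by rewrite in_itv/= leey andbT lee_fin ltW.
have [A B] : (weighted_Lp p (fun t => t `^ beta)%R u <= e%:E)%E /\
    (weighted_Lp p (fun t => t `^ beta)%R (weak_derivative u) <= e%:E)%E.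
  move: (weighted_Lp_ge0 (fun t => t `^ beta) u)
    (weighted_Lp_ge0 (fun t => t `^ beta) (weak_derivative u)) ue.
  rewrite /W1p_norm; move: (weighted_Lp _ _ u) (weighted_Lp _ _ (weak_derivative u)) => x y x0 y0.
  by move=> /ltW xy; split; apply: le_trans xy; rewrite ?leeDl ?leeDr.
by split; [exact (H u A)|exact (H (weak_derivative u) B)].
Qed.

Lemma W1p_norm_small u e : 0 < e ->
  (energy p beta u <= ((e / 4) `^ p)%:E)%E ->
  (energy p beta (weak_derivative u) <= ((e / 4) `^ p)%:E)%E ->
  (W1p_norm p beta u < e%:E)%E.
Proof.
move=> e0 H1 H2.
have e40 : 0 <= e / 4 by lra.
have H f : (energy p beta f <= ((e / 4) `^ p)%:E)%E ->
    (weighted_Lp p (fun t => t `^ beta)%R f <= (e / 4)%:E)%E.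
  move=> K; have pV0 : 0 <= p^-1 by rewrite invr_ge0 ltW.
  have := gt0_ler_poweR pV0 _ _ K.
  rewrite poweR_EFin -powRrM mulfV ?gt_eqF// powRr1//; apply.
    by rewrite in_itv/= leey andbT energy_ge0.
  by rewrite in_itv/= leey andbT lee_fin powR_ge0.
apply: (le_lt_trans (leeD (H _ H1) (H _ H2))).
by rewrite -EFinD lte_fin; lra.
Qed.

Lemma energy_ae (f g : R -> R) b : measurable_fun Rpos f -> measurable_fun Rpos g ->
  {ae mu, forall x, Rpos x -> f x = g x} -> energy p b f = energy p b g.
Proof.
move=> mf mg fg; apply: ge0_ae_eq_integral.
- exact: measurable_Rpos.
- exact: measurable_weighted.
- exact: measurable_weighted.
- by move=> x _; rewrite lee_fin mulr_ge0 ?powR_ge0.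
- by move=> x _; rewrite lee_fin mulr_ge0 ?powR_ge0.
- by case: fg => N [mN N0 sub]; exists N; split => // x /= nx; apply: sub => /= H;
    apply: nx => /H ->.
Qed.

(** The norm is defined with a chosen weak derivative; its value can be
computed with any other one. *)
Lemma energy_weak_derivative u v : {in Rpos, continuous u} ->
  is_weak_derivative u v -> energy p beta (weak_derivative u) = energy p beta v.
Proof.
move=> cu uv; apply: energy_ae (weak_derivative_ae cu uv).
- have [_ [? _ _] _] : is_weak_derivative u (weak_derivative u).
    by apply: weak_derivativeP; split => //; exists v.
  by [].
- by case: uv => _ [].
Qed.

End norms.

(** * Smooth approximation in weighted Lebesgue spaces *)

Section energy_estimates.
Context {R : realType}.
Notation mu := (@lebesgue_measure R).
Variable p : R.
Hypothesis p0 : 0 < p.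
Implicit Types (f h F : R -> R) (D E : set R) (g t x : R).

Lemma powR_normD (a b : R) : `|a + b| `^ p <= 2 `^ p * (`|a| `^ p + `|b| `^ p).
Proof.
wlog ab : a b / `|a| <= `|b| => [H|].
  have [/H//|/ltW /H] := leP `|a| `|b|.
  by rewrite addrC [X in _ * X]addrC.
apply: (@le_trans _ _ ((2 * `|b|) `^ p)).
  rewrite ge0_ler_powR ?nnegrE ?(ltW p0)// ?mulr_ge0//.
  by apply: le_trans (ler_normD _ _) _; rewrite mulrDl mul1r lerD2r.
by rewrite powRM// ler_wpM2l ?powR_ge0// lerDr powR_ge0.
Qed.

Lemma le_energy_on D g f F : measurable D -> measurable_fun D f ->
  measurable_fun D F ->
  (forall x, D x -> `|f x| `^ p * x `^ g <= F x) ->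
  (energy_on p D g f <= \int[mu]_(x in D) (F x)%:E)%E.
Proof.
move=> mD mf mF fF; apply: ge0_le_integral.
- exact: mD.
- by move=> x _; rewrite lee_fin mulr_ge0 ?powR_ge0.
- exact: measurable_weighted.
- by apply/measurable_EFinP; exact: mF.
- by move=> x Dx; rewrite lee_fin fF.
Qed.

Lemma energy_onD D g f h : measurable D -> measurable_fun D f ->
  measurable_fun D h ->
  (energy_on p D g (f \+ h)%R <=
   (2 `^ p)%:E * (energy_on p D g f + energy_on p D g h))%E.
Proof.
move=> mD mf mh.
have mfE := @measurable_weighted _ D f p g mf.
have mhE := @measurable_weighted _ D h p g mh.
have E0 (k : R -> R) x : (0 <= (`|k x| `^ p * x `^ g)%:E)%E.
  by rewrite lee_fin mulr_ge0 ?powR_ge0.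
rewrite /energy_on -(@ge0_integralD _ _ _ mu D mD _ _ (fun x _ => E0 f x) mfE
  (fun x _ => E0 h x) mhE).
have mS : measurable_fun D (fun x => (`|f x| `^ p * x `^ g)%:E +
    (`|h x| `^ p * x `^ g)%:E)%E by exact: emeasurable_funD.
rewrite -(@ge0_integralZl _ _ _ mu D mD _ mS); first last.
- by rewrite lee_fin powR_ge0.
- by move=> x _; rewrite adde_ge0.
apply: ge0_le_integral.
- exact: mD.
- by move=> x _; exact: (E0 (f \+ h)%R).
- by apply: measurable_weighted; exact: measurable_funD.
- exact: measurable_funeM.
- move=> x _; rewrite -EFinD -EFinM lee_fin -mulrDl mulrA.
  by rewrite ler_wpM2r ?powR_ge0// powR_normD.
Qed.

Lemma energy_onD_le D g f h (a b : R) : measurable D -> measurable_fun D f ->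
  measurable_fun D h -> (energy_on p D g f <= a%:E)%E ->
  (energy_on p D g h <= b%:E)%E ->
  (energy_on p D g (f \+ h)%R <= (2 `^ p * (a + b))%:E)%E.
Proof.
move=> mD mf mh fa hb; apply: le_trans (energy_onD g mD mf mh) _.
by rewrite EFinM EFinD lee_wpmul2l ?lee_fin ?powR_ge0// leeD.
Qed.

Lemma energy_on_cvg0 D g (f_ : nat -> R -> R) F : measurable D -> D `<=` Rpos ->
  (forall n, measurable_fun D (f_ n)) -> mu.-integrable D (EFin \o F) ->
  (forall n x, D x -> `|f_ n x| `^ p * x `^ g <= F x) ->
  (forall x, D x -> f_ n x @[n --> \oo] --> 0) ->
  forall e, 0 < e -> \forall n \near \oo, (energy_on p D g (f_ n) <= e%:E)%E.
Proof.
move=> mD DR mf iF fF f0 e e0.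
have := @dominated_cvg_EFin R D (fun n x => `|f_ n x| `^ p * x `^ g) (cst 0) F mD.
have -> : (\int[mu]_(x in D) (cst 0 x)%:E = 0)%E by exact: integral0.
have H1 : forall n, measurable_fun D (fun x => `|f_ n x| `^ p * x `^ g).
  move=> n; apply: measurable_funM; last exact: measurable_powRl.
  exact: measurable_normr_powR.
have H2 : forall x, D x -> `|f_ n x| `^ p * x `^ g @[n --> \oo] --> (0 : R).
  move=> x Dx; have /RposP x0 := DR _ Dx.
  apply/cvgrPdist_le => d d0.
  have xg : 0 < x `^ g by rewrite powR_gt0.
  have c0 : 0 < (d / x `^ g) `^ p^-1 by rewrite powR_gt0// divr_gt0.
  have /cvgrPdist_le /(_ _ c0) := f0 x Dx.
  apply: filterS => n; rewrite !sub0r !normrN => fn.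
  rewrite ger0_norm ?mulr_ge0 ?powR_ge0// -ler_pdivlMr//.
  apply: (@le_trans _ _ (((d / x `^ g) `^ p^-1) `^ p)).
    by rewrite ge0_ler_powR ?nnegrE ?(ltW p0)// ltW.
  by rewrite -powRrM mulVf ?gt_eqF// powRr1// divr_ge0 ?ltW.
have H3 : forall n x, D x -> `| `|f_ n x| `^ p * x `^ g| <= F x.
  by move=> n x Dx; rewrite ger0_norm ?mulr_ge0 ?powR_ge0// fF.
move=> /(_ H1 (measurable_cst _) H2 iF H3).
move=> /fine_cvgP[Fn /cvgrPdist_le /(_ _ e0) Fe]; near=> n.
have Fi : (\int[mu]_(x in D) (`|f_ n x| `^ p * x `^ g)%:E)%E \is a fin_num.
  by near: n; exact: Fn.
rewrite /energy_on -(fineK Fi) lee_fin.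
have : `|0 - fine (\int[mu]_(x in D) (`|f_ n x| `^ p * x `^ g)%:E)%E| <= e.
  by near: n; exact: Fe.
by apply: le_trans; rewrite sub0r normrN ler_norm.
Unshelve. all: by end_near. Qed.

End energy_estimates.

Section smooth_density.
Context {R : realType}.
Notation mu := (@lebesgue_measure R).
Implicit Types (f h g F : R -> R) (t x : R).

(** Differences of consecutive translates of a rescaled step form a smooth
partition of unity of mesh 1/N, the i-th piece being concentrated within 1/N of
the node a + i/N. *)
Let piece (N a : R) (i : nat) x : R := step (N * (x - a) + 1 - i%:R) - step (N * (x - a) - i%:R).

Let piece_ge0 N a i x : 0 <= piece N a i x.
Proof. by rewrite subr_ge0; apply: step_homo; lra. Qed.

Let sum_piece N a m x : 0 <= N * (x - a) -> N * (x - a) + 1 <= m%:R ->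
  \sum_(0 <= i < m) piece N a i x = 1.
Proof.
move=> y0 ym; pose f i := - step (N * (x - a) + 1 - i%:R).
under eq_bigr => i _.
  rewrite (_ : piece N a i x = f i.+1 - f i); last first.
    by rewrite /f /piece opprK addrC -natr1 opprD addrA addrAC addrK.
  over.
have S0 : step (N * (x - a) + 1 - m%:R) = 0 by rewrite step_le0// subr_le0.
have S1 : step (N * (x - a) + 1 - 0%:R) = 1 by rewrite step_ge1// subr0 lerDr.
by rewrite telescope_sumr// /f S0 S1 oppr0 sub0r opprK.
Qed.

Let piece_neq0 N a i x : 0 < N -> piece N a i x != 0 -> `|x - (a + i%:R / N)| <= N^-1.
Proof.
move=> N0; apply: contraNT; rewrite -ltNge => H.
have {}H : 1 < `|N * (x - a) - i%:R|.
  have -> : N * (x - a) - i%:R = N * (x - (a + i%:R / N)).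
    by field; rewrite gt_eqF.
  by rewrite normrM gtr0_norm// -ltr_pdivrMl// mulr1.
rewrite /piece; move: H; set y := N * (x - a); rewrite lter_normr => /orP[H|H].
  by rewrite !step_ge1 ?subrr//; lra.
by rewrite !step_le0 ?subrr//; lra.
Qed.

(** The number of nodes is such that the pieces sum to 1 on all of [a, b]. *)
Let node_count (N a b : R) := (Num.truncn (N * (b - a))).+2.

Let interpolant g (n : nat) (a b x : R) : R :=
  \sum_(0 <= i < node_count n.+1%:R a b) g (a + i%:R / n.+1%:R) * piece n.+1%:R a i x.

Let smooth_interpolant g n a b : smooth (interpolant g n a b).
Proof.
apply: smooth_sum => i; apply: smoothZ; apply: smoothB.
  have -> : (fun x => step (n.+1%:R * (x - a) + 1 - i%:R)) =
      (fun x => step (n.+1%:R * x + (1 - i%:R - n.+1%:R * a))).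
    by apply/funext => x; congr step; ring.
  by apply: smooth_affine; exact: smooth_step.
have -> : (fun x => step (n.+1%:R * (x - a) - i%:R)) =
    (fun x => step (n.+1%:R * x + (- i%:R - n.+1%:R * a))).
  by apply/funext => x; congr step; ring.
by apply: smooth_affine; exact: smooth_step.
Qed.

(** The value of the interpolant at x is an average of values of g at points
within 1/(n+1) of x. *)
Let interpolant_sub g n a b x c (e : R) : a <= x <= b ->
  (forall y, `|x - y| <= n.+1%:R^-1 -> `|c - g y| <= e) ->
  `|c - interpolant g n a b x| <= e.
Proof.
move=> /andP[ax xb] ge.
have N0 : 0 < n.+1%:R :> R by rewrite ltr0n.
have S1 : \sum_(0 <= i < node_count n.+1%:R a b) piece n.+1%:R a i x = 1.
  apply: sum_piece; first by rewrite mulr_ge0// subr_ge0.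
  rewrite /node_count -[in leRHS]natr1 lerD2r; apply: le_trans (ltW (truncnS_gt _)).
  by rewrite ler_wpM2l ?(ltW N0)// lerD2r.
rewrite -[c]mulr1 -S1 mulr_sumr -sumrB.
apply: (le_trans (ler_norm_sum _ _ _)).
have -> : e = \sum_(0 <= i < node_count n.+1%:R a b) e * piece n.+1%:R a i x.
  by rewrite -mulr_sumr S1 mulr1.
apply: ler_sum => i _.
rewrite -mulrBl normrM (ger0_norm (piece_ge0 _ _ _ _)).
have [->|p0] := eqVneq (piece n.+1%:R a i x) 0; first by rewrite !mulr0.
by rewrite ler_wpM2r ?piece_ge0// ge// piece_neq0.
Qed.

Let interpolant_cvg g a b x : continuous g -> a <= x <= b ->
  interpolant g n a b x @[n --> \oo] --> g x.
Proof.
move=> cg xab; apply/cvgrPdist_le => e e0.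
have /cvgrPdist_le /(_ _ e0) [d /= d0 gd] := cg x.
near=> n; apply: interpolant_sub => // y yx; apply: gd => /=.
by apply: le_lt_trans yx _; near: n; exact: near_infty_natSinv_lt (PosNum d0).
Unshelve. all: by end_near. Qed.

Variables (p beta : R).
Hypothesis p1 : 1 < p.
Let p0 : 0 < p. Proof. exact: lt_trans ltr01 p1. Qed.

Lemma integrable_powR_itv (g a b : R) : 0 < a -> mu.-integrable `[a, b] (EFin \o (fun x => x `^ g)).
Proof.
move=> a0; apply: continuous_compact_integrable; first exact: segment_compact.
exact: within_continuous_powR.
Qed.

(** The interpolants of g converge pointwise and are uniformly bounded, so that
dominated convergence applies. *)
Lemma continuous_smooth_approx g (a b e : R) : continuous g -> 0 < a -> 0 < e ->
  exists2 h, smooth h & (energy_on p `[a, b] beta (g \- h)%R <= e%:E)%E.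
Proof.
move=> cg a0 e0.
(* The values of g averaged at x are taken at a distance at most 1 from x. *)
have [M M0 gM] := continuous_bounded_on (a - 1) (b + 1) cg.
have ab0 : `[a, b] `<=` @Rpos R by exact: subset_itv_Rpos.
have mf n : measurable_fun `[a, b] (g \- interpolant g n a b).
  apply: measurable_funTS; apply: measurable_funB.
    exact: continuous_measurable_fun.
  by apply: continuous_measurable_fun; exact: smooth_continuous.
have iF : mu.-integrable `[a, b] (EFin \o (fun x => (2 * M) `^ p * x `^ beta)).
  apply: (@eq_integrable _ _ _ mu _ (measurable_itv _)
    (fun x => ((2 * M) `^ p)%:E * (x `^ beta)%:E)%E) => //.
  apply: (@integrableZl _ _ _ mu _ (measurable_itv _)).
  exact: integrable_powR_itv.
have fF n x : `[a, b]%classic x ->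
    `|(g \- interpolant g n a b) x| `^ p * x `^ beta <= (2 * M) `^ p * x `^ beta.
  rewrite /= in_itv/= => xab; rewrite ler_wpM2r ?powR_ge0//.
  rewrite ge0_ler_powR ?nnegrE ?(ltW p0)// ?mulr_ge0 ?(ltW M0)//.
  apply: interpolant_sub => // y xy.
  have y1 : `|x - y| <= 1 by apply: le_trans xy _; rewrite invf_le1 ?ler1n ?ltr0n.
  have gx := gM x; have gy := gM y; move: xab y1; rewrite ler_norml => /andP[ax xb] /andP[y1 y2].
  apply: (le_trans (ler_normB _ _)); rewrite mulr2n mulrDl mul1r lerD//.
    by apply: gx; apply/andP; split; lra.
  by apply: gy; apply/andP; split; lra.
have f0 x : `[a, b]%classic x -> (g \- interpolant g n a b) x @[n --> \oo] --> (0 : R).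
  rewrite /= in_itv/= => xab; rewrite -(subrr (g x)); apply: cvgB; first exact: cvg_cst.
  exact: interpolant_cvg.
have [n _ Hn] := energy_on_cvg0 p0 (measurable_itv _) ab0 mf iF fF f0 e0.
by exists (interpolant g n a b) => //; apply: Hn => /=.
Qed.

(** Continuous functions are dense in the space of integrable functions. If the
approximant is truncated at height M, it does not get farther from f, and then
|f - h|^p <= (2 M)^(p-1) |f - h|. *)
Lemma bounded_continuous_approx f (a b M e : R) : 0 < a -> 0 < M -> 0 < e ->
  measurable_fun `[a, b] f -> (forall x, a <= x <= b -> `|f x| <= M) ->
  exists2 g, continuous g & (energy_on p `[a, b] beta (f \- g)%R <= e%:E)%E.
Proof.
move=> a0 M0 e0 mf fM.
pose D := `[a, b]%classic : set R.
have [W W0 Wb] : exists2 W, 0 < W & forall x, D x -> x `^ beta <= W.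
  have [ab|ba] := leP a b; last first.
    by exists 1 => // x; rewrite /D/= in_itv/= => /andP[ax xb]; lra.
  have [c _ cM] := @EVT_max R (fun x => x `^ beta) a b ab (@within_continuous_powR R beta a b a0).
  exists (c `^ beta + 1); first by rewrite ltr_wpDl// powR_ge0.
  by move=> x Dx; apply: (le_trans (cM x Dx)); rewrite lerDl.
have muD : (mu D < +oo)%E by rewrite /D lebesgue_measure_itv/=; case: ifP; rewrite ltry.
have fi : mu.-integrable D (EFin \o f).
  apply: measurable_bounded_integrable => //; first exact: measurable_itv.
  exists M; split; first exact: num_real.
  by move=> y My x /=; rewrite /D/= in_itv/= => xab; apply: le_trans (fM _ xab) (ltW My).
have [g_ [cg ig gcvg]] := approximation_continuous_integrable (measurable_itv _) muD fi.
pose K := (2 * M) `^ (p - 1) * W.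
have K0 : 0 < K by rewrite mulr_gt0// powR_gt0// mulr_gt0.
have eK : 0 < e / K by rewrite divr_gt0.
have [n Hn] : exists n, (\int[mu]_(z in D) `|(f z - g_ n z)%:E| <= (e / K)%:E)%E.
  move/fine_cvgP : gcvg => [Fn /cvgrPdist_le /(_ _ eK) Fe].
  near \oo => n; exists n.
  have Fi : (\int[mu]_(z in D) `|(f z - g_ n z)%:E|)%E \is a fin_num.
    by near: n; exact: Fn.
  rewrite -(fineK Fi) lee_fin.
  have : `|0 - fine (\int[mu]_(z in D) `|(f z - g_ n z)%:E|)%E| <= e / K.
    by near: n; exact: Fe.
  by apply: le_trans; rewrite sub0r normrN ler_norm.
pose h x := Num.max (- M) (Num.min M (g_ n x)).
have ch : continuous h.
  move=> x; apply: (@continuous_max _ _ (cst (- M)) (fun x => Num.min M (g_ n x))).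
    exact: cst_continuous.
  by apply: (@continuous_min _ _ (cst M) (g_ n)); [exact: cst_continuous|exact: cg].
have hM x : `|h x| <= M.
  rewrite ler_norml /h le_max lexx ge_max ge_min lexx andbT/=.
  by rewrite (le_trans _ (ltW M0))// oppr_le0 ltW.
have hf x : D x -> `|f x - h x| <= `|f x - g_ n x|.
  rewrite /D/= in_itv/= => /fM; rewrite ler_norml => /andP[f1 f2].
  rewrite /h; case: (leP M (g_ n x)) => g1; last case: (leP (- M) (g_ n x)) => g2 //.
    rewrite max_r; last by lra.
    rewrite ler0_norm; last lra.
    by rewrite ler0_norm; lra.
  rewrite ger0_norm; last lra.
  by rewrite ger0_norm; lra.
exists h => //.
have mg : measurable_fun D (g_ n) by apply: measurable_funTS; exact: continuous_measurable_fun.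
have mh : measurable_fun D h by apply: measurable_funTS; exact: continuous_measurable_fun.
apply: (@le_trans _ _ (\int[mu]_(x in D) (K * `|f x - g_ n x|)%:E)%E).
  apply: le_energy_on => //.
  - exact: measurable_funB.
  - apply: measurable_funM => //; apply: measurableT_comp => //.
    exact: measurable_funB.
  - move=> x Dx; rewrite /= -mulr_powRB1//.
    rewrite [X in X * _ <= _]mulrC -mulrA [X in _ * X <= _]mulrC mulrA /K.
    apply: ler_pM; rewrite ?mulr_ge0 ?powR_ge0//; last exact: hf.
    apply: ler_pM; rewrite ?powR_ge0//; last exact: Wb.
    have pm0 : 0 <= p - 1 by rewrite subr_ge0 ltW.
    rewrite ge0_ler_powR ?nnegrE ?mulr_ge0 ?(ltW M0)//.
    have xab : a <= x <= b by move: Dx; rewrite /D/= in_itv.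
    apply: (le_trans (ler_normB _ _)); rewrite mulr2n mulrDl mul1r lerD//.
    exact: fM.
have mE : measurable_fun D (fun x => (`|f x - g_ n x|)%:E).
  by apply/measurable_EFinP; apply: measurableT_comp => //; exact: measurable_funB.
under eq_integral do rewrite EFinM.
rewrite (@ge0_integralZl _ _ _ mu D (measurable_itv _) _ mE); first last.
- by rewrite lee_fin ltW.
- by move=> x _; rewrite lee_fin.
apply: (@le_trans _ _ (K%:E * (e / K)%:E)%E).
  by rewrite lee_wpmul2l// lee_fin ltW.
by rewrite -EFinM lee_fin mulrC mulfVK ?gt_eqF.
Unshelve. all: by end_near. Qed.

Lemma truncation_approx f (a b e : R) : 0 < a -> 0 < e ->
  measurable_fun `[a, b] f -> (energy_on p `[a, b] beta f < +oo)%E ->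
  exists (M : R) (h : R -> R), [/\ 0 < M, measurable_fun `[a, b] h, (forall x, `|h x| <= M) &
    (energy_on p `[a, b] beta (f \- h)%R <= e%:E)%E].
Proof.
move=> a0 e0 mf fy.
have ab0 : `[a, b] `<=` @Rpos R by exact: subset_itv_Rpos.
pose f_ n x := f x * (`|f x| <= n%:R)%R%:R.
have mf_ n : measurable_fun `[a, b] (f_ n).
  apply: measurable_funM => //.
  apply: (@measurableT_comp _ _ _ _ _ _ (fun z : bool => z%:R : R)) => //.
  by apply: measurable_fun_ler => //; exact: measurableT_comp.
have iF : mu.-integrable `[a, b] (EFin \o (fun x => `|f x| `^ p * x `^ beta)).
  apply/integrableP; split; first exact: measurable_weighted.
  apply: le_lt_trans fy; rewrite le_eqVlt; apply/orP; left; apply/eqP.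
  by apply: eq_integral => x _ /=; rewrite ger0_norm// mulr_ge0 ?powR_ge0.
have mB n : measurable_fun `[a, b] (f \- f_ n) by exact: measurable_funB.
have fF n x : `[a, b]%classic x ->
    `|(f \- f_ n) x| `^ p * x `^ beta <= `|f x| `^ p * x `^ beta.
  move=> _; rewrite ler_wpM2r ?powR_ge0// ge0_ler_powR ?nnegrE ?(ltW p0)//.
  by rewrite /= /f_; case: (`|f x| <= n%:R); rewrite ?mulr1 ?mulr0 ?subrr ?subr0 ?normr0.
have f0 x : `[a, b]%classic x -> (f \- f_ n) x @[n --> \oo] --> (0 : R).
  move=> _; apply: cvg_near_cst; exists (Num.truncn `|f x|).+1 => // n /= fn.
  rewrite /f_; suff -> : `|f x| <= n%:R by rewrite mulr1 subrr.
  by apply: le_trans (ltW (truncnS_gt _)) _; rewrite ler_nat.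
have [n _ Hn] := energy_on_cvg0 p0 (measurable_itv _) ab0 mB iF fF f0 e0.
exists n.+1%:R, (f_ n); split => //.
- move=> x; rewrite /f_; case: (leP `|f x| n%:R) => fn; rewrite ?mulr1 ?mulr0 ?normr0//.
  by apply: (le_trans fn); rewrite ler_nat.
- by apply: Hn => /=.
Qed.

(** Truncate f, approximate the truncation by a continuous function, and that
one by a smooth function. *)
Lemma Lp_smooth_approx f (a b e : R) : 0 < a -> 0 < e ->
  measurable_fun `[a, b] f -> (energy_on p `[a, b] beta f < +oo)%E ->
  exists2 h, smooth h & (energy_on p `[a, b] beta (f \- h)%R <= e%:E)%E.
Proof.
move=> a0 e0 mf fy.
pose c := 2 `^ p; have c0 : 0 < c by rewrite powR_gt0.
pose d := e / (c * (1 + c * 2)).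
have d0 : 0 < d by rewrite divr_gt0// mulr_gt0//; lra.
have [M [k [M0 mk kM fk]]] := truncation_approx a0 d0 mf fy.
have [g cg kg] := bounded_continuous_approx a0 M0 d0 mk (fun x _ => kM x).
have [h sh gh] := continuous_smooth_approx b cg a0 d0.
exists h => //.
have mg : measurable_fun `[a, b] g by apply: measurable_funTS; exact: continuous_measurable_fun.
have mh : measurable_fun `[a, b] h.
  by apply: measurable_funTS; apply: continuous_measurable_fun; exact: smooth_continuous.
have -> : f \- h = (f \- k) \+ ((k \- g) \+ (g \- h)).
  by apply/funext => x /=; ring.
have kh := energy_onD_le p0 (measurable_itv _) (measurable_funB mk mg) (measurable_funB mg mh) kg gh.
have fh := energy_onD_le p0 (measurable_itv _) (measurable_funB mf mk)
  (measurable_funD (measurable_funB mk mg) (measurable_funB mg mh)) fk kh.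
apply: (le_trans fh); rewrite lee_fin -/c.
have -> : c * (d + c * (d + d)) = d * (c * (1 + c * 2)) by ring.
by rewrite /d mulfVK// gt_eqF// mulr_gt0//; lra.
Qed.

End smooth_density.

(** * Approximation by test functions *)

Section cutoff_density.
Context {R : realType}.
Notation mu := (@lebesgue_measure R).
Variables (p beta : R).
Hypotheses (p1 : 1 < p) (betap : beta < p - 1).
Implicit Types (u v f h : R -> R) (t x : R).

Let p0 : 0 < p. Proof. exact: lt_trans ltr01 p1. Qed.

(** The first factor rises on [1/(n+1), 2/(n+1)] and the second one falls on
[n+1, 2(n+1)]. *)
Let cutoff n x : R := step (n.+1%:R * x - 1) * (1 - step (n.+1%:R^-1 * x - 1)).

Let smooth_cutoff n : smooth (cutoff n).
Proof.
apply: smoothM; first by apply: smooth_affine; exact: smooth_step.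
apply: smoothB; first exact: smooth_cst.
by apply: smooth_affine; exact: smooth_step.
Qed.

Let cutoff_bound n x : 0 <= cutoff n x <= 1.
Proof.
rewrite /cutoff; have := step_ge0 (n.+1%:R * x - 1).
have := step_le1 (n.+1%:R * x - 1).
have := step_ge0 (n.+1%:R^-1 * x - 1); have := step_le1 (n.+1%:R^-1 * x - 1).
move: (step _) (step _) => s r s1 s0 r1 r0.
by rewrite mulr_ge0 ?subr_ge0//= mulr_ile1// ?subr_ge0// gerBl.
Qed.

Let cutoff_eq0 n x : ~~ (n.+1%:R^-1 <= x <= 2 * n.+1%:R) -> cutoff n x = 0.
Proof.
have N0 : 0 < n.+1%:R :> R by rewrite ltr0n.
rewrite negb_and -!ltNge /cutoff => /orP[xn|nx].
  by rewrite step_le0 ?mul0r// subr_le0 -ler_pdivlMl// mulr1 ltW.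
rewrite [X in _ * (1 - X)]step_ge1 ?subrr ?mulr0//.
by rewrite lerBrDr -ler_pdivrMl ?invr_gt0// invrK mulrC ltW.
Qed.

Let cutoff_eq1 n x : 2 / n.+1%:R <= x <= n.+1%:R -> cutoff n x = 1.
Proof.
have N0 : 0 < n.+1%:R :> R by rewrite ltr0n.
rewrite /cutoff => /andP[nx xn]; rewrite step_ge1; last first.
  by rewrite lerBrDr -ler_pdivrMl// mulrC.
by rewrite step_le0 ?subr0 ?mulr1// subr_le0 -ler_pdivlMl ?invr_gt0// invrK mulr1.
Qed.

Let derive1_cutoff_aux (c d x : R) :
  derive1 (fun x => step (c * x - 1) * (1 - step (d * x - 1))) x =
  c * derive1 step (c * x - 1) * (1 - step (d * x - 1)) -
  step (c * x - 1) * (d * derive1 step (d * x - 1)).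
Proof.
have sa (k : R) : smooth (fun x : R => step (k * x - 1)).
  by apply: smooth_affine; exact: smooth_step.
pose s2 := cst (1 : R) \- (fun x : R => step (d * x - 1)).
have ss2 : smooth s2 by apply: smoothB => //; exact: smooth_cst.
have := is_deriveM (smooth_is_derive (sa c) x) (smooth_is_derive ss2 x).
move=> /@derive_val; rewrite -derive1E => ->.
rewrite derive1B//; last exact: smooth_cst.
have dA (k : R) : derive1 (fun x : R => step (k * x - 1)) x = k * derive1 step (k * x - 1).
  exact: (@derive1_affine R step k (-1) x (@smooth_step R)).
rewrite derive1_cst sub0r (dA c) (dA d).
rewrite /s2 /GRing.scale/=.
move: (derive1 step (c * x - 1)) (derive1 step (d * x - 1)).
by move: (step (c * x - 1)) (step (d * x - 1)) => r s r' s'; ring.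
Qed.

Let derive1_cutoff n x : derive1 (cutoff n) x =
  n.+1%:R * derive1 step (n.+1%:R * x - 1) * (1 - step (n.+1%:R^-1 * x - 1)) -
  step (n.+1%:R * x - 1) * (n.+1%:R^-1 * derive1 step (n.+1%:R^-1 * x - 1)).
Proof.
exact: derive1_cutoff_aux.
Qed.

Let derive1_cutoff_eq0 n x : 2 / n.+1%:R <= x <= n.+1%:R -> derive1 (cutoff n) x = 0.
Proof.
have N0 : 0 < n.+1%:R :> R by rewrite ltr0n.
move=> /andP[nx xn]; rewrite derive1_cutoff.
rewrite !derive1_step_eq0 ?mulr0 ?mul0r ?subrr//.
  by rewrite negb_and -!leNgt subr_le0 -ler_pdivlMl ?invr_gt0// invrK mulr1 xn.
by rewrite negb_and -!leNgt lerBrDr -ler_pdivrMl// [_^-1 * _]mulrC nx orbT.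
Qed.

(** The derivative of step (c x - 1) vanishes unless c x < 2, and it is at most
c times a constant; so it is at most a constant times 2/x, whatever c is. *)
Let derive1_cutoff_bound : exists2 M, 0 < M &
  forall n x, 0 < x -> `|derive1 (cutoff n) x| <= M / x.
Proof.
have [M M0 HM] := @derive1_step_bounded R; exists (4 * M); first by rewrite mulr_gt0.
have B (c x : R) : 0 < c -> 0 < x -> c * derive1 step (c * x - 1) <= 2 * M / x.
  move=> c0 x0; have [cx|] := boolP (0 < c * x - 1 < 1); last first.
    by move=> /derive1_step_eq0 ->; rewrite mulr0 divr_ge0 ?mulr_ge0 ?ltW.
  rewrite ler_pdivlMr// mulrAC; apply: ler_pM; rewrite ?derive1_step_ge0//.
    by rewrite mulr_ge0 ?ltW.
  by move: cx => /andP[_ cx]; lra.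
move=> n x x0; rewrite derive1_cutoff.
have N0 : 0 < n.+1%:R :> R by rewrite ltr0n.
have NV0 : 0 < n.+1%:R^-1 :> R by rewrite invr_gt0.
have B1 := B _ _ N0 x0; have B2 := B _ _ NV0 x0.
have P1 : 0 <= n.+1%:R * derive1 step (n.+1%:R * x - 1).
  by rewrite mulr_ge0 ?derive1_step_ge0 ?ltW.
have P2 : 0 <= n.+1%:R^-1 * derive1 step (n.+1%:R^-1 * x - 1).
  by rewrite mulr_ge0 ?derive1_step_ge0 ?ltW.
have := step_ge0 (n.+1%:R * x - 1); have := step_le1 (n.+1%:R * x - 1).
have := step_ge0 (n.+1%:R^-1 * x - 1); have := step_le1 (n.+1%:R^-1 * x - 1).
move: P1 P2 B1 B2.
move: (n.+1%:R * _) (n.+1%:R^-1 * _) (step _) (step _) => A1 A2 r s A10 A20 A1c A2c.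
move=> r1 r0 s1 s0.
have -> : 4 * M / x = 2 * M / x + 2 * M / x.
  by rewrite -!mulrDl -natrD.
apply: (le_trans (ler_normB _ _)).
rewrite !ger0_norm ?mulr_ge0 ?subr_ge0//.
apply: lerD.
  by apply: le_trans A1c; rewrite ler_piMr// gerBl.
by apply: le_trans A2c; rewrite ler_piMl.
Qed.

Let cutoff_near x : 0 < x -> \forall n \near \oo, 2 / n.+1%:R <= x <= n.+1%:R.
Proof.
move=> x0; have x2 : 0 < x / 2 by rewrite divr_gt0.
near=> n; apply/andP; split.
  rewrite mulrC -ler_pdivlMr// ltW//.
  by near: n; exact: near_infty_natSinv_lt (PosNum x2).
near: n; exists (Num.truncn x) => // n /= xn.
by apply: le_trans (ltW (truncnS_gt x)) _; rewrite ler_nat ltnS.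
Unshelve. all: by end_near. Qed.

(** The term chi' u is bounded by a constant times |u|/x, so that a multiple of
|u|^p x^(beta-p) dominates the integrand of its energy; for each x, both
functions vanish when n is large. *)
Let cutoff_error u v : measurable_fun Rpos u -> measurable_fun Rpos v ->
  (energy p beta u < +oo)%E -> (energy p beta v < +oo)%E ->
  (energy p (beta - p) u < +oo)%E -> forall e, 0 < e -> exists n,
  (energy p beta (fun x => (1 - cutoff n x) * u x)%R <= e%:E)%E /\
  (energy p beta (fun x => (1 - cutoff n x) * v x - derive1 (cutoff n) x * u x)%R <= e%:E)%E.
Proof.
move=> mu_ mv Iu Iv Ihu e e0.
have mc n : measurable_fun Rpos (cutoff n).
  by apply: measurable_funTS; apply: continuous_measurable_fun; exact: smooth_continuous.
have mc' n : measurable_fun Rpos (derive1 (cutoff n)).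
  apply: measurable_funTS; apply: continuous_measurable_fun.
  exact/smooth_continuous/smooth_derive.
have [M M0 HM] := derive1_cutoff_bound.
have m1 n (f : R -> R) : measurable_fun Rpos f ->
    measurable_fun Rpos (fun x => (1 - cutoff n x) * f x).
  by move=> mf; apply: measurable_funM => //; exact: measurable_funB.
have m2 n : measurable_fun Rpos
    (fun x => (1 - cutoff n x) * v x - derive1 (cutoff n) x * u x).
  by apply: measurable_funB; [exact: m1|exact: measurable_funM].
have c1 n x (y : R) : `|(1 - cutoff n x) * y| <= `|y|.
  have /andP[c0 c1] := cutoff_bound n x.
  by rewrite normrM ger0_norm ?subr_ge0// ler_piMl// gerBl.
have b1 n x : Rpos x ->
    `|(1 - cutoff n x) * u x| `^ p * x `^ beta <= `|u x| `^ p * x `^ beta.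
  by move=> _; rewrite ler_wpM2r ?powR_ge0// ge0_ler_powR ?nnegrE ?(ltW p0).
have b2 n x : Rpos x ->
    `|(1 - cutoff n x) * v x - derive1 (cutoff n) x * u x| `^ p * x `^ beta <=
    2 `^ p * (`|v x| `^ p * x `^ beta + M `^ p * (`|u x| `^ p * x `^ (beta - p))).
  move=> /RposP x0.
  apply: (@le_trans _ _ (2 `^ p * (`|v x| `^ p + (M / x * `|u x|) `^ p) * x `^ beta)).
    rewrite ler_wpM2r ?powR_ge0//; apply: (le_trans (powR_normD p0 _ _)).
    rewrite ler_wpM2l ?powR_ge0// lerD//.
      by rewrite ge0_ler_powR ?nnegrE ?(ltW p0).
    rewrite ge0_ler_powR ?nnegrE ?(ltW p0)//.
      by rewrite mulr_ge0// divr_ge0 ?ltW.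
    by rewrite normrN normrM ler_wpM2r// HM.
  rewrite -mulrA ler_wpM2l ?powR_ge0// mulrDl lerD2l.
  rewrite powRM ?divr_ge0 ?(ltW M0) ?(ltW x0)// powRM ?invr_ge0 ?(ltW M0) ?(ltW x0)//.
  rewrite -powR_inv1 ?(ltW x0)// -powRrM mulN1r.
  rewrite -!mulrA ler_wpM2l ?powR_ge0// mulrCA ler_wpM2l ?powR_ge0//.
  by rewrite -powRD ?(gt_eqF x0) ?implybT// addrC.
have i1 := integrable_energy mu_ Iu.
have i2 : mu.-integrable Rpos (EFin \o (fun x =>
    2 `^ p * (`|v x| `^ p * x `^ beta + M `^ p * (`|u x| `^ p * x `^ (beta - p))))).
  have iv := integrable_energy mv Iv; have ih := integrable_energy mu_ Ihu.
  have ih' := integrableZl measurable_Rpos (M `^ p) ih.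
  have i3 := integrableZl measurable_Rpos (2 `^ p) (integrableD measurable_Rpos iv ih').
  exact: i3.
have f1 x : Rpos x -> (1 - cutoff n x) * u x @[n --> \oo] --> (0 : R).
  move=> /RposP x0; apply: cvg_near_cst; apply: filterS (cutoff_near x0) => n /cutoff_eq1 ->.
  by rewrite subrr mul0r.
have f2 x : Rpos x -> (1 - cutoff n x) * v x - derive1 (cutoff n) x * u x @[n --> \oo] --> (0 : R).
  move=> /RposP x0; apply: cvg_near_cst; apply: filterS (cutoff_near x0) => n nx.
  by rewrite cutoff_eq1// derive1_cutoff_eq0// subrr !mul0r subrr.
have K1 := energy_on_cvg0 p0 measurable_Rpos (@subset_refl _ _) (fun n => m1 n u mu_) i1 b1 f1 e0.
have K2 := energy_on_cvg0 p0 measurable_Rpos (@subset_refl _ _) m2 i2 b2 f2 e0.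
have [N _ HN] := filterI K1 K2.
exists N; exact (HN N (leqnn N)).
Qed.

Lemma energy_supported (D : set R) g f : D `<=` Rpos ->
  (forall x, Rpos x -> ~ D x -> f x = 0) -> energy p g f = energy_on p D g f.
Proof.
move=> DR f0; apply: integral_supported => // x Rx nD.
by rewrite f0// normr0 powR0 ?mul0r// gt_eqF.
Qed.

(** The restriction to [a, b] under the integral gives the bound the form that
the weighted Hölder inequality takes as input. *)
Let antiderivative_error u v h a b : {in Rpos, continuous u} ->
  is_weak_derivative u v -> smooth h -> 0 < a ->
  forall x, a <= x <= b ->
  (`|u x - (u a + (antiderivative h x - antiderivative h a))|%:E <=
   \int[mu]_(t in `]0%R, b]) `|((v \- h)%R \_ `[a, b]) t|%:E)%E.
Proof.
move=> cu uv sh a0 x /andP[ax xb].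
have [_ lv _] := uv; have ch := smooth_continuous sh.
have dF (y : R) : is_derive y 1 (antiderivative h) (h y) by exact: is_derive_antiderivative.
have sF : smooth (antiderivative h) by exact: is_derive_smooth sh.
have F' : derive1 (antiderivative h) = h.
  by apply/funext => y; rewrite derive1E; exact: derive_val.
have iv : mu.-integrable `[a, x] (EFin \o v) by exact: locally_integrable_itv.
have ih : mu.-integrable `[a, x] (EFin \o h) by exact: continuous_integrable_itv.
have -> : u x - (u a + (antiderivative h x - antiderivative h a)) =
    (\int[mu]_(t in `[a, x]) (v t - h t))%R.
  rewrite (@RintegralB _ _ _ mu `[a, x] _ _ (measurable_itv _) iv ih).
  rewrite -(weak_derivative_FTC cu uv a0 ax) -[in RHS]F' Rintegral_derive1//.
  by rewrite opprD addrA.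
have ivh : mu.-integrable `[a, x] (EFin \o (v \- h)).
  exact (@integrableB _ _ _ mu `[a, x] (measurable_itv _) _ _ iv ih).
rewrite (@EFin_normr_Rintegral _ _ _ mu `[a, x] _ (measurable_itv _) ivh).
apply: (@le_trans _ _ (\int[mu]_(t in `[a, x]) `|(v t - h t)|%:E)%E).
  apply: (le_abse_integral mu (measurable_itv _)).
  by case/integrableP : ivh.
have -> : (\int[mu]_(t in `]0%R, b]) `|((v \- h)%R \_ `[a, b]) t|%:E =
    \int[mu]_(t in `[a, b]) `|v t - h t|%:E)%E.
  rewrite (@integral_supported _ `]0, b] `[a, b]).
  - by apply: eq_integral => t tab; rewrite patchE tab.
  - by move=> t /=; rewrite !in_itv/= => /andP[at_ ->]; rewrite andbT (lt_le_trans a0).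
  - by move=> t _ tab; rewrite patchE memNset// normr0.
apply: ge0_subset_integral.
- exact: measurable_itv.
- exact: measurable_itv.
- apply/measurable_EFinP; apply: measurableT_comp => //.
  have /measurable_int/measurable_EFinP mvb := locally_integrable_itv b lv a0.
  apply: measurable_funB; first exact: mvb.
  by apply: measurable_funTS; exact: continuous_measurable_fun.
- by move=> t _; rewrite lee_fin.
- by apply: subset_itvl; rewrite bnd_simp.
Qed.

(** With chi a cutoff and G an antiderivative of a smooth approximation h of v,
the test function is phi = chi G, and the errors are

  u - phi = (1 - chi) u + chi (u - G),
  v - phi' = ((1 - chi) v - chi' u) + (chi' (u - G) + chi (v - h)).

The first summands are small for a suitable chi. Once chi is chosen, the others
are small for a suitable h, since u - G is bounded on the support of chi by the
energy of v - h. *)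
Lemma test_function_density u v : {in Rpos, continuous u} ->
  is_weak_derivative u v ->
  (energy p beta u < +oo)%E -> (energy p beta v < +oo)%E ->
  (energy p (beta - p) u < +oo)%E -> forall e, 0 < e ->
  exists phi, [/\ test_function phi, (energy p beta (u \- phi)%R <= e%:E)%E &
    (energy p beta (v \- derive1 phi)%R <= e%:E)%E].
Proof.
move=> cu uv Iu Iv Ihu e e0.
have mu_ := continuous_Rpos_measurable cu; have [_ [mv _ _] _] := uv.
pose c := 2 `^ p; have c0 : 0 < c by rewrite powR_gt0.
(* Each splitting into two summands costs a factor c, and there are two. *)
pose d := e / (c * (2 + c * 2)).
have d0 : 0 < d by rewrite divr_gt0// mulr_gt0//; move: c0; lra.
have eE : d * (c * (2 + c * 2)) = e.
  by rewrite /d mulfVK// gt_eqF// mulr_gt0//; move: c0; lra.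
have budget1 : c * (d + d) <= d * (c * (2 + c * 2)).
  have -> : d * (c * (2 + c * 2)) = c * (d + d) + c * c * (2 * d) by ring.
  by rewrite lerDl (mulr_ge0 (mulr_ge0 (ltW c0) (ltW c0)))// mulr_ge0// ltW.
have budget2 : c * (d + c * (d + d)) <= d * (c * (2 + c * 2)).
  have -> : d * (c * (2 + c * 2)) = c * (d + c * (d + d)) + c * d by ring.
  by rewrite lerDl mulr_ge0// ltW.
have [n [A1 A2]] := cutoff_error mu_ mv Iu Iv Ihu d0.
set chi := cutoff n in A1 A2.
have schi : smooth chi by exact: smooth_cutoff.
pose a : R := n.+1%:R^-1; pose b : R := 2 * n.+1%:R.
have a0 : 0 < a by rewrite invr_gt0 ltr0n.
have ab : a < b.
  have n1 : 1 <= n.+1%:R :> R by rewrite ler1n.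
  have : a <= 1 by rewrite invf_le1// ltr0n.
  by rewrite /b; move: n1; move: (n.+1%:R : R) => N; lra.
have b0 : 0 < b := lt_trans a0 ab.
have abR : `[a, b] `<=` @Rpos R by exact: subset_itv_Rpos.
have chi0 x : ~~ (a <= x <= b) -> chi x = 0 by exact: cutoff_eq0.
have chi0' x : ~~ (a <= x <= b) -> derive1 chi x = 0 by exact: derive1_supported.
have [M M0 HM] := derive1_cutoff_bound.
have [C C0 CH] := weighted_hoelder p1 betap.
pose K := C * b `^ (p - 1 - beta); have K0 : 0 < K by rewrite mulr_gt0// powR_gt0.
have iW := @integrable_powR_itv R beta a b a0.
pose W := (\int[mu]_(x in `[a, b]) (x `^ beta))%R.
have W0 : 0 <= W by apply: Rintegral_ge0 => x _; exact: powR_ge0.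
have WE : (\int[mu]_(x in `[a, b]) (x `^ beta)%:E = W%:E)%E.
  rewrite /W /Rintegral fineK//.
  by apply: integrable_fin_num => //; exact: iW.
pose M2 := M / a; have M20 : 0 < M2 by rewrite divr_gt0.
(* For e' the energy of v - h, |u - G|^p <= K e' on [a, b], where the integral
   of the weight is W; on the same interval chi' is at most M2. *)
pose L := 1 + K * W * (1 + M2 `^ p).
have L0 : 0 < L.
  rewrite ltr_pwDl// mulr_ge0//; first by rewrite mulr_ge0// ltW.
  by rewrite addr_ge0// powR_ge0.
pose d' := d / L; have d'0 : 0 < d' by rewrite divr_gt0.
have mvab : measurable_fun `[a, b] v.
  by apply: measurable_funS mv => //; exact: measurable_Rpos.
have Ivab : (energy_on p `[a, b] beta v < +oo)%E.
  apply: le_lt_trans Iv; apply: ge0_subset_integral.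
  - exact: measurable_itv.
  - exact: measurable_Rpos.
  - exact: measurable_weighted.
  - by move=> x _; rewrite lee_fin mulr_ge0 ?powR_ge0.
  - exact: abR.
have [h sh vh] := Lp_smooth_approx p1 a0 d'0 mvab Ivab.
have ch := smooth_continuous sh.
pose G x := u a + (antiderivative h x - antiderivative h a).
have dF (y : R) : is_derive y 1 (antiderivative h) (h y) by exact: is_derive_antiderivative.
have sF : smooth (antiderivative h) by exact: is_derive_smooth sh.
have sG : smooth G.
  apply: (@smoothD _ (cst (u a)) (antiderivative h \- cst (antiderivative h a))).
    exact: smooth_cst.
  by apply: smoothB => //; exact: smooth_cst.
have G' y : derive1 G y = h y.
  rewrite derive1E; apply: derive_val; rewrite -[h y]add0r -[X in 0 + X]subr0.
  by apply: is_deriveD; apply: is_deriveB.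
pose phi := chi \* G.
have phi' x : derive1 phi x = chi x * h x + derive1 chi x * G x.
  rewrite derive1E; apply: derive_val.
  have := is_deriveM (smooth_is_derive schi x) (smooth_is_derive sG x).
  by rewrite G' /GRing.scale/= [G x * _]mulrC.
pose E x := u x - G x.
have mh (D : set R) : measurable_fun D h.
  by apply: measurable_funTS; exact: continuous_measurable_fun.
have mE : measurable_fun Rpos E.
  apply: measurable_funB => //; apply: measurable_funTS.
  by apply: continuous_measurable_fun; exact: smooth_continuous.
have mchi (D : set R) : measurable_fun D chi.
  by apply: measurable_funTS; apply: continuous_measurable_fun; exact: smooth_continuous.
have mchi' (D : set R) : measurable_fun D (derive1 chi).
  apply: measurable_funTS; apply: continuous_measurable_fun.
  exact/smooth_continuous/smooth_derive.
have mEab : measurable_fun `[a, b] E.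
  by apply: measurable_funS mE => //; exact: measurable_Rpos.
have EK x : a <= x <= b -> `|E x| `^ p <= K * d'.
  move=> xab; have := antiderivative_error cu uv sh a0 xab => Ex.
  have mw : measurable_fun Rpos ((v \- h) \_ `[a, b]).
    apply: measurable_funTS; apply/(measurable_restrictT _ _).1; first exact: measurable_itv.
    exact: measurable_funB.
  rewrite -lee_fin.
  apply: le_trans (_ : _ <= K%:E * energy_on p `[a, b] beta (v \- h)%R)%E _; last first.
    by rewrite [leRHS]EFinM; apply: lee_wpmul2l => //; rewrite lee_fin ltW.
  have -> : energy_on p `[a, b] beta (v \- h)%R =
      (\int[mu]_(x in `]0%R, b]) (`|((v \- h)%R \_ `[a, b]) x| `^ p * x `^ beta)%:E)%E.
    rewrite [RHS](@integral_supported _ `]0, b] `[a, b]).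
    - by apply: eq_integral => t tab; rewrite patchE tab.
    - by move=> t /=; rewrite !in_itv/= => /andP[at_ ->]; rewrite andbT (lt_le_trans a0).
    - by move=> t _ tab; rewrite patchE memNset// normr0 powR0 ?mul0r// gt_eqF.
  apply: le_trans (CH _ _ mw b0).
  rewrite -poweR_EFin; apply: (gt0_ler_poweR (ltW p0) _ _ Ex).
  - by rewrite in_itv/= leey andbT lee_fin.
  - by rewrite in_itv/= leey andbT integral_ge0// => t _; rewrite lee_fin.
have multE (k : R -> R) (m : R) : measurable_fun `[a, b] k -> 0 <= m ->
    (forall x, a <= x <= b -> `|k x| <= m) ->
    (energy_on p `[a, b] beta (fun x => k x * E x)%R <= (m `^ p * (K * d') * W)%:E)%E.
  move=> mk m0 km.
  have mkE : measurable_fun `[a, b] (fun x => k x * E x) by exact: measurable_funM.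
  rewrite [X in (_ <= X)%E]EFinM -WE -(@ge0_integralZl _ _ _ mu _ (measurable_itv _)); first last.
  - by rewrite lee_fin (mulr_ge0 (powR_ge0 _ _)) ?(mulr_ge0 (ltW K0) (ltW d'0)).
  - by move=> x _; rewrite lee_fin powR_ge0.
  - by apply/measurable_EFinP; exact: measurable_powRl.
  apply: (le_energy_on (measurable_itv _) mkE).
    by apply: measurable_funM; [exact: measurable_cst|exact: measurable_powRl].
  move=> x; rewrite /= in_itv/= => xab; rewrite ler_wpM2r ?powR_ge0//.
  rewrite normrM powRM//; apply: ler_pM; rewrite ?powR_ge0//; last exact: EK.
  by rewrite ge0_ler_powR ?nnegrE ?(ltW p0)// km.
have d'L : d' * L = d by rewrite /d' mulfVK// gt_eqF.
have KW0 : 0 <= K * W by rewrite mulr_ge0// ltW.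
have M2p : 0 <= M2 `^ p by exact: powR_ge0.
have B1 : (energy p beta (fun x => chi x * E x)%R <= d%:E)%E.
  rewrite (energy_supported beta abR); last first.
    by move=> x _ /negP; rewrite in_itv/= => /chi0 ->; rewrite mul0r.
  apply: (le_trans (multE chi 1 (mchi _) ler01 _)).
    move=> x _; have /andP[x0 x1] := cutoff_bound n x.
    by rewrite ger0_norm.
  rewrite lee_fin powR1 mul1r -d'L /L.
  have -> : K * d' * W = d' * (K * W) by rewrite mulrAC mulrC.
  rewrite ler_wpM2l ?(ltW d'0)//.
  by move: KW0 M2p; move: (K * W) (M2 `^ p) => x y; nra.
have B2 : (energy p beta (fun x => derive1 chi x * E x + chi x * (v x - h x))%R <= (c * (d + d))%:E)%E.
  rewrite (energy_supported beta abR); last first.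
    move=> x _ /negP; rewrite in_itv/= => xab.
    by rewrite chi0// chi0'// !mul0r addr0.
  apply: (energy_onD_le p0 (measurable_itv _)).
  - exact: measurable_funM.
  - by apply: measurable_funM => //; exact: measurable_funB.
  - apply: (le_trans (multE (derive1 chi) M2 (mchi' _) (ltW M20) _)).
      move=> x /andP[ax _]; have x0 := lt_le_trans a0 ax.
      apply: (le_trans (HM n x x0)).
      by rewrite ler_pM2l// lef_pV2 ?posrE.
    rewrite lee_fin -d'L /L.
    have AC (x y z t : R) : x * (y * z) * t = z * (y * t * x) by ring.
    rewrite AC.
    rewrite ler_wpM2l ?(ltW d'0)//.
    by move: KW0 M2p; move: (K * W) (M2 `^ p) => x y; nra.
  - have mcvh : measurable_fun `[a, b] (fun x => chi x * (v x - h x)).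
      by apply: measurable_funM => //; exact: measurable_funB.
    apply: (@le_trans _ _ d'%:E); last first.
      rewrite lee_fin -d'L -[leLHS]mulr1 ler_wpM2l ?(ltW d'0)// lerDl.
      by rewrite mulr_ge0// addr_ge0.
    apply: le_trans vh; apply: (le_energy_on (measurable_itv _) mcvh).
      apply: measurable_funM; last exact: measurable_powRl.
      by apply: measurable_normr_powR; exact: measurable_funB.
    move=> x _; rewrite ler_wpM2r ?powR_ge0// ge0_ler_powR ?nnegrE ?(ltW p0)//.
    have /andP[x0 x1] := cutoff_bound n x.
    by rewrite normrM ger0_norm// ler_piMl.
exists phi; split.
- apply/test_functionP; split; first exact: smoothM.
  by exists a, b; split => // x /chi0 cx; rewrite /phi/= cx mul0r.
- have -> : u \- phi = (fun x => (1 - chi x) * u x) \+ (fun x => chi x * E x).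
    by apply/funext => x; rewrite /phi /E/=; move: (chi x) (u x) (G x) => *; ring.
  apply: le_trans (energy_onD_le p0 measurable_Rpos _ _ A1 B1) _.
  + by apply: measurable_funM => //; exact: measurable_funB.
  + exact: measurable_funM.
  + by rewrite lee_fin -/c -eE budget1.
- have -> : v \- derive1 phi = (fun x => (1 - chi x) * v x - derive1 chi x * u x) \+
      (fun x => derive1 chi x * E x + chi x * (v x - h x)).
    apply/funext => x; rewrite /= phi' /E/=.
    by move: (chi x) (derive1 chi x) (u x) (v x) (G x) (h x) => *; ring.
  apply: le_trans (energy_onD_le p0 measurable_Rpos _ _ A2 B2) _.
  + apply: measurable_funB; apply: measurable_funM => //.
    exact: measurable_funB.
  + apply: measurable_funD; apply: measurable_funM => //.
    exact: measurable_funB.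
  + by rewrite lee_fin -/c -eE budget2.
Qed.

End cutoff_density.

(** * The subspaces of functions vanishing at the origin *)

Section spaces.
Context {R : realType}.
Notation mu := (@lebesgue_measure R).
Variables (p beta : R).
Hypotheses (p1 : 1 < p) (betap : beta < p - 1).
Implicit Types (u v f : R -> R) (t x L : R).

Let p0 : 0 < p. Proof. exact: lt_trans ltr01 p1. Qed.

Lemma W1pP u : W1p p beta u <-> [/\ W11loc R u, (energy p beta u < +oo)%E &
  (energy p beta (weak_derivative u) < +oo)%E].
Proof.
split=> [[wu nu]|[wu Iu Iv]].
  by have [Iu Iv] := (W1p_normP beta p1 u).1 nu.
by split => //; apply: (W1p_normP beta p1 u).2.
Qed.

Lemma Y1p_weight u : {in Rpos, continuous u} ->
  (\int[mu]_(t in Rpos) (`|u t| `^ p * (t `^ beta * (1 + 1 / t `^ p)))%:E =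
   energy p beta u + energy p (beta - p) u)%E.
Proof.
move=> cu; have mu_ := continuous_Rpos_measurable cu.
rewrite /energy /energy_on -ge0_integralD; first last.
- exact: measurable_weighted.
- by move=> x _; rewrite lee_fin mulr_ge0 ?powR_ge0.
- exact: measurable_weighted.
- by move=> x _; rewrite lee_fin mulr_ge0 ?powR_ge0.
- exact: measurable_Rpos.
apply: eq_integral => x; rewrite RposE => x0.
rewrite -EFinD -mulrDr; congr (_ * _)%:E.
rewrite mulrDr mulr1 div1r -powRN -powRD//.
by rewrite (gt_eqF x0) implybT.
Qed.

Lemma Y1pP u : Y1p p beta u <->
  W1p p beta u /\ (energy p (beta - p) u < +oo)%E.
Proof.
have H := adde_lty (weighted_Lp_ge0 p (fun t => t `^ beta * (1 + 1 / t `^ p)) u)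
  (weighted_Lp_ge0 p (fun t => t `^ beta) (weak_derivative u)).
have K := weighted_Lp_lty p1 (fun t => t `^ beta * (1 + 1 / t `^ p)) u.
have J := weighted_Lp_lty p1 (fun t => t `^ beta) (weak_derivative u).
have E := adde_lty (energy_ge0 p beta u) (energy_ge0 p (beta - p) u).
split=> [[wu nu]|[/W1pP[wu Iu Iv] Ihu]].
  have [A B] := proj1 H nu; have [cu _] := wu.
  have A' := proj1 K A.
  rewrite (Y1p_weight cu) in A'.
  have [Iu Ihu] := proj1 E A'.
  have Iv := proj1 J B.
  split; last exact Ihu.
  by apply/W1pP; split; [exact wu|exact Iu|exact Iv].
have [cu _] := wu; split; first exact wu.
apply: (proj2 H); split; last exact (proj2 J Iv).
have A' := proj2 E (conj Iu Ihu).
rewrite -(Y1p_weight cu) in A'.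
exact (proj2 K A').
Qed.

Lemma W1p_trace u : W1p p beta u -> exists2 L, u t @[t --> 0^'+] --> L &
  forall t, 0 < t ->
    (`|u t - L|%:E <= \int[mu]_(x in `]0%R, t]) `|weak_derivative u x|%:E)%E.
Proof.
move=> /W1pP[wu Iu Iv]; have uv := weak_derivativeP wu.
have [L HL] := trace_exists p1 betap wu.1 uv Iv; exists L => //.
by apply: (trace_cvg p1 betap _ Iv HL); case: uv => _ [].
Qed.

(** Any limit at 0 is the one of [W1p_trace]. *)
Lemma trace_le u L t : W1p p beta u -> u t @[t --> 0^'+] --> L -> 0 < t ->
  (`|u t - L|%:E <= \int[mu]_(x in `]0%R, t]) `|weak_derivative u x|%:E)%E.
Proof.
move=> /W1p_trace[L' uL' H] uL t0.
by rewrite (cvg_unique (@Rhausdorff R) uL uL'); exact: H.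
Qed.

Lemma W1p_weighted_cvg u L : W1p p beta u -> u t @[t --> 0^'+] --> L ->
  t `^ ((beta - (p - 1)) / p) * `|u t - L| @[t --> 0^'+] --> (0 : R).
Proof.
move=> Wu uL; have /W1pP[wu _ Iv] := Wu; have [_ [mv _ _] _] := weak_derivativeP wu.
by apply: (trace_weighted_cvg p1 betap mv Iv) => t; exact: trace_le.
Qed.

Lemma cvg_at_right_seq (t_ : nat -> R) : (forall n, 0 < t_ n) ->
  t_ n @[n --> \oo] --> (0 : R) -> t_ n @[n --> \oo] --> (0 : R)^'+.
Proof.
move=> t0 t_0 A HA.
have {}HA : \forall n \near \oo, 0 < t_ n -> A (t_ n) by exact: (t_0 _ HA).
by apply: filterS HA => n; apply; exact: t0.
Qed.

(** A limit at 0 exists, and any sequence tending to 0 determines it. *)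
Lemma A0_B0 : A0 p beta = B0 p beta.
Proof.
apply/seteqP; split=> u [Wu H]; split => //.
  have [L uL _] := W1p_trace Wu; have [t_ [t0 _ t_0 ut0]] := H.
  suff L0 : L = 0 by rewrite L0 in uL.
  apply: (cvg_unique (@Rhausdorff R)) ut0.
  exact: cvg_comp (cvg_at_right_seq t0 t_0) uL.
have t0 n : 0 < n.+1%:R^-1 :> R by rewrite invr_gt0 ltr0n.
exists (fun n => n.+1%:R^-1); split => //.
- by move=> m n mn; rewrite lef_pV2 ?posrE ?ltr0n// ler_nat.
- exact: cvg_harmonic.
- exact: cvg_comp (cvg_at_right_seq t0 (@cvg_harmonic R)) H.
Qed.

Let weightE : (beta - p + 1) / p = (beta - (p - 1)) / p.
Proof. by congr (_ / _); ring. Qed.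

Lemma B0_C0 : B0 p beta = C0 p beta.
Proof.
apply/seteqP; split=> u [Wu H]; split => //.
  apply/norm_cvg0P; have := W1p_weighted_cvg Wu H.
  rewrite weightE; apply: cvg_trans; apply: near_eq_cvg; near=> t.
  by rewrite /= subr0 normrM mulrC (ger0_norm (powR_ge0 _ _)).
apply: (weighted_cvg_cvg p1 betap); have : `|u t * t `^ ((beta - p + 1) / p)| @[t --> 0^'+] --> `|0 : R| by exact: cvg_norm.
rewrite normr0 weightE; apply: cvg_trans; apply: near_eq_cvg; near=> t.
by rewrite /= subr0 normrM mulrC (ger0_norm (powR_ge0 _ _)).
Unshelve. all: by end_near. Qed.

(** One inclusion is Hardy's inequality; the other holds because the weight
t^(beta-p) is not integrable at 0. *)
Lemma B0_Y1p : B0 p beta = Y1p p beta.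
Proof.
apply/seteqP; split=> u.
  move=> [Wu u0]; apply/Y1pP; split => //.
  have /W1pP[wu _ Iv] := Wu; have [_ [mv _ _] _] := weak_derivativeP wu.
  have [C C0 CH] := hardy p1 betap.
  apply: le_lt_trans (CH u _ (continuous_Rpos_measurable wu.1) mv _) _.
    by move=> t t0; have := trace_le Wu u0 t0; rewrite subr0.
  by rewrite lte_mul_pinfty ?lee_fin ?(ltW C0).
move=> /Y1pP[Wu Ihu]; split => //; have [L uL _] := W1p_trace Wu.
have [L0|L0] := eqVneq L 0; first by rewrite L0 in uL.
have /W1pP[[cu _] _ _] := Wu.
have gp : beta - p <= -1 by move: betap; lra.
have E := energy_div p1 (continuous_Rpos_measurable cu) gp uL L0.
by rewrite E ltxx in Ihu.
Qed.

Lemma test_function_smooth phi : test_function phi -> @smooth R phi.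
Proof. by move=> /test_functionP[]. Qed.

Lemma test_function_weak_derivative u phi : W11loc R u -> test_function phi ->
  is_weak_derivative (u \- phi) (weak_derivative u \- derive1 phi).
Proof.
move=> wu /test_function_smooth sphi; apply: is_weak_derivativeB.
  exact: weak_derivativeP.
exact: smooth_is_weak_derivative.
Qed.

Lemma test_function_W11loc u phi : W11loc R u -> test_function phi ->
  W11loc R (u \- phi).
Proof.
move=> wu tphi; split.
  move=> x Rx; apply: continuousB; first exact: wu.1.
  exact: (smooth_continuous (test_function_smooth tphi)).
by exists (weak_derivative u \- derive1 phi); exact: test_function_weak_derivative.
Qed.

Lemma B0_sub_W1p0 : B0 p beta `<=` W1p0 p beta.
Proof.
move=> u Bu; have [Wu _] := Bu; split => // e e0.
have /Y1pP[_ Ihu] : Y1p p beta u by rewrite -B0_Y1p.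
have /W1pP[wu Iu Iv] := Wu; have uv := weak_derivativeP wu.
have e4 : 0 < (e / 4) `^ p by rewrite powR_gt0 ?divr_gt0.
have [phi [tphi H1 H2]] := test_function_density p1 betap wu.1 uv Iu Iv Ihu e4.
have [cw _] := test_function_W11loc wu tphi.
exists phi; first exact tphi.
rewrite -(energy_weak_derivative p beta cw (test_function_weak_derivative wu tphi)) in H2.
exact (W1p_norm_small p1 e0 H1 H2).
Qed.

(** The trace is continuous: on [1, 2], the constant L is the sum of u and
L - u, and the energies of both there are at most a constant times e. *)
Lemma trace_norm_bound : exists2 K, 0 < K & forall u L e, W1p p beta u ->
  u t @[t --> 0^'+] --> L -> 0 < e ->
  (energy p beta u <= e%:E)%E -> (energy p beta (weak_derivative u) <= e%:E)%E ->
  `|L| `^ p <= K * e.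
Proof.
have [C C0 CH] := trace_bound p1 betap.
(* A lower bound for the weight on [1, 2] that is valid for both signs of beta. *)
pose m := 2 `^ (- `|beta|) : R; have m0 : 0 < m by rewrite powR_gt0.
have mle x : 1 <= x <= 2 -> m <= x `^ beta.
  move=> /andP[x1 x2]; apply: (@le_trans _ _ (x `^ (- `|beta|))).
    rewrite /m !powRN lef_pV2 ?posrE ?powR_gt0//; last lra.
    by rewrite ge0_ler_powR ?nnegrE//; lra.
  by rewrite ler_powR// lerNl -normrN ler_norm.
pose c := 2 `^ p * (1 + C * 2 `^ (p - 1)).
have c0 : 0 < c by rewrite mulr_gt0 ?powR_gt0// ltr_pwDl// mulr_ge0 ?powR_ge0// ltW.
exists (m^-1 * c); first by rewrite mulr_gt0// invr_gt0.
move=> u L e Wu uL e0 Iu Iv.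
have /W1pP[wu _ _] := Wu; have [_ [mv _ _] _] := weak_derivativeP wu.
have sR : `[(1 : R), 2] `<=` Rpos by exact: subset_itv_Rpos.
have mu_ : measurable_fun `[(1 : R), 2] u.
  by apply: measurable_funS sR (continuous_Rpos_measurable wu.1); exact: measurable_Rpos.
have Iu12 : (energy_on p `[1%R, 2%R] beta u <= e%:E)%E.
  apply: le_trans Iu; apply: ge0_subset_integral.
  - exact: measurable_itv.
  - exact: measurable_Rpos.
  - by apply: measurable_weighted; exact: (continuous_Rpos_measurable wu.1).
  - by move=> x _; rewrite lee_fin mulr_ge0 ?powR_ge0.
  - exact: sR.
have mLu : measurable_fun `[(1 : R), 2] (fun x => L - u x).
  by apply: measurable_funB => //; exact: measurable_cst.
have lebesgue12 (k : R) : 0 <= k -> (\int[mu]_(x in `[(1 : R)%R, (2 : R)%R]) k%:E = k%:E)%E.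
  move=> k0; rewrite integral_cst; last exact: measurable_itv.
  have E : lebesgue_measure `[(1 : R), 2] = 1%E.
    rewrite lebesgue_measure_itv/= lte_fin ltr1n -EFinB (_ : 2 - 1 = 1 :> R)//.
    by move: p1; lra.
  by rewrite -[RHS]mule1; congr (_ * _)%E; exact: E.
have ILu : (energy_on p `[1%R, 2%R] beta (fun x => L - u x)%R <= (C * 2 `^ (p - 1) * e)%:E)%E.
  have k0 : 0 <= C * 2 `^ (p - 1) * e by rewrite !mulr_ge0 ?powR_ge0// ltW.
  rewrite -(lebesgue12 _ k0); apply: (le_energy_on (measurable_itv _) mLu).
    exact: measurable_cst.
  move=> x; rewrite /= in_itv/= => /andP[x1 x2]; have x0 : 0 < x by lra.
  have := CH _ _ _ _ mv x0 (trace_le Wu uL x0).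
  have Jx : (\int[mu]_(y in `]0%R, x]) (`|weak_derivative u y| `^ p * y `^ beta)%:E <= e%:E)%E.
    apply: le_trans Iv; apply: ge0_subset_integral.
    - exact: measurable_itv.
    - exact: measurable_Rpos.
    - exact: measurable_weighted.
    - by move=> y _; rewrite lee_fin mulr_ge0 ?powR_ge0.
    - exact: subset_oc_Rpos.
  have k1 : 0 <= C * x `^ (p - 1 - beta) by rewrite mulr_ge0 ?powR_ge0// ltW.
  move=> H; have {H} := le_trans H (lee_wpmul2l (k1 : (0 <= (_ : R)%:E)%E) Jx).
  rewrite -EFinM lee_fin => H; rewrite distrC.
  apply: (@le_trans _ _ (C * x `^ (p - 1 - beta) * e * x `^ beta)).
    by rewrite ler_wpM2r ?powR_ge0.
  rewrite mulrAC ler_wpM2r ?(ltW e0)// -mulrA ler_wpM2l ?(ltW C0)//.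
  rewrite -powRD; last by rewrite (gt_eqF x0) implybT.
  by rewrite subrK ge0_ler_powR ?nnegrE//; move: p1; lra.
have : (energy_on p `[(1 : R)%R, (2 : R)%R] beta (u \+ (fun x => L - u x))%R <=
    (2 `^ p * (e + C * 2 `^ (p - 1) * e))%:E)%E.
  by apply: (energy_onD_le p0 (measurable_itv _)).
have -> : u \+ (fun x => L - u x) = cst L by apply/funext => x /=; rewrite addrCA subrr addr0.
move=> H; rewrite -mulrA ler_pdivlMl// -lee_fin -lebesgue12; last first.
  by rewrite mulr_ge0 ?powR_ge0// ltW.
have mLw : measurable_fun `[(1 : R), 2] (fun x => `|L| `^ p * x `^ beta).
  by apply: measurable_funM; [exact: measurable_cst|exact: measurable_powRl].
apply: (@le_trans _ _ (energy_on p `[1%R, 2%R] beta (cst L))).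
  apply: ge0_le_integral.
  - exact: measurable_itv.
  - by move=> x _; rewrite lee_fin mulr_ge0 ?powR_ge0// ltW.
  - exact: measurable_cst.
  - by apply/measurable_EFinP; exact: mLw.
  - by move=> x /= xI; rewrite lee_fin mulrC ler_wpM2l ?powR_ge0// mle// -in_itv.
apply: (le_trans H); rewrite lee_fin /c.
by rewrite -[leRHS]mulrA mulrDl mul1r.
Qed.

(** Subtracting a test function does not change the trace, which is thus bounded
by arbitrarily small norms. *)
Lemma W1p0_sub_B0 : W1p0 p beta `<=` B0 p beta.
Proof.
move=> u [Wu H]; split => //; have [L uL _] := W1p_trace Wu.
have [L0|L0] := eqVneq L 0; first by rewrite L0 in uL.
have [K K0 KH] := trace_norm_bound.
have Lp : 0 < `|L| `^ p by rewrite powR_gt0 ?normr_gt0.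
pose eta := `|L| `^ p / (2 * K).
have eta0 : 0 < eta by rewrite divr_gt0// mulr_gt0.
have e0 : 0 < eta `^ p^-1 by rewrite powR_gt0.
have eE : (eta `^ p^-1) `^ p = eta by rewrite -powRrM mulVf ?gt_eqF// powRr1// ltW.
have [phi tphi nphi] := H _ e0.
have [Iw Iw'] := W1p_norm_lt p1 e0 nphi; rewrite eE in Iw Iw'.
have /W1pP[wu _ _] := Wu.
have Ww : W1p p beta (u \- phi).
  by split; [exact: test_function_W11loc|exact: lt_trans nphi (ltry _)].
have wL : (u \- phi) t @[t --> 0^'+] --> L.
  have /test_functionP[_ [a [b [a0 _ phi0]]]] := tphi.
  apply: cvg_trans uL; apply: near_eq_cvg; near=> t.
  rewrite /= phi0 ?subr0// negb_and -ltNge.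
  by apply/orP; left; near: t; exact: nbhs_right_lt.
have := KH _ _ _ Ww wL eta0 Iw Iw'.
rewrite /eta mulrC -mulrA invfM mulfVK ?gt_eqF// => {}H.
by move: H Lp; move: (`|L| `^ p) => x; lra.
Unshelve. all: by end_near. Qed.

Lemma W1p0_B0 : W1p0 p beta = B0 p beta.
Proof. by apply/seteqP; split; [exact: W1p0_sub_B0|exact: B0_sub_W1p0]. Qed.

Lemma Tr0_lim u L : u t @[t --> 0^'+] --> L -> Tr0 u = L.
Proof. by move=> uL; apply: cvg_lim => //; exact: Rhausdorff. Qed.

Lemma W1p_trace0 u L : beta <= -1 -> W1p p beta u ->
  u t @[t --> 0^'+] --> L -> L = 0.
Proof.
move=> b1 /W1pP[[cu _] Iu _] uL; have [//|L0] := eqVneq L 0.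
by rewrite (energy_div p1 (continuous_Rpos_measurable cu) b1 uL L0) in Iu.
Qed.

Lemma bounded_energy f (b m : R) : -1 < beta -> 0 < b -> measurable_fun Rpos f ->
  (forall x, `|f x| <= m) -> (forall x, b < x -> f x = 0) ->
  (energy p beta f < +oo)%E.
Proof.
move=> b1 b0 mf fm f0.
have sub : `]0, b] `<=` @Rpos R by exact: subset_oc_Rpos.
rewrite (@energy_supported _ _ p1 `]0, b])//; last first.
  move=> x /RposP x0 /negP; rewrite /= in_itv/= x0/= -ltNge; exact: f0.
apply: (@le_lt_trans _ _ ((m `^ p)%:E * \int[mu]_(x in `]0%R, b]) (x `^ beta)%:E)%E).
  rewrite -(@ge0_integralZl _ _ _ mu _ (measurable_itv _)); first last.
  - by rewrite lee_fin powR_ge0.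
  - by move=> x _; rewrite lee_fin powR_ge0.
  - by apply/measurable_EFinP; exact: measurable_powRl.
  apply: (le_energy_on (measurable_itv _)).
  - by apply: measurable_funS sub mf; exact: measurable_Rpos.
  - by apply: measurable_funM; [exact: measurable_cst|exact: measurable_powRl].
  - move=> x _; rewrite ler_wpM2r ?powR_ge0// ge0_ler_powR ?nnegrE ?(ltW p0)//.
    by apply: le_trans (fm x).
rewrite lte_mul_pinfty ?lee_fin ?powR_ge0//.
by apply: le_lt_trans (integral_powR_near0 b1 b0) _; rewrite ltry.
Qed.

(** The witness is equal to r on ]0, 1] and to 0 on [2, +oo[. *)
Lemma trace_surj (r : R) : -1 < beta ->
  exists2 u, W1p p beta u & u t @[t --> 0^'+] --> r.
Proof.
move=> b1; pose u x : R := r * (1 - step (1 * x - 1)).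
have ss : smooth (fun x : R => step (1 * x - 1)).
  by apply: smooth_affine; exact: smooth_step.
have s1 : smooth (cst 1 \- (fun x : R => step (1 * x - 1))).
  by apply: smoothB => //; exact: smooth_cst.
have su : smooth u by exact: smoothZ.
have u' x : derive1 u x = - (r * derive1 step (1 * x - 1)).
  rewrite derive1E; apply: derive_val.
  have ds := smooth_is_derive ss x.
  have -> : - (r * derive1 step (1 * x - 1)) =
      r *: (0 - derive1 (fun x : R => step (1 * x - 1)) x).
    by rewrite derive1_affine ?mul1r ?sub0r ?scalerN//; exact: smooth_step.
  exact: is_deriveZ.
have mf f : smooth f -> measurable_fun Rpos f.
  move=> sf; apply: measurable_funTS; apply: continuous_measurable_fun.
  exact: smooth_continuous.
have wu : W11loc R u.
  split; first by move=> x _; exact: smooth_continuous.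
  by exists (derive1 u); exact: smooth_is_weak_derivative.
exists u; last first.
  apply: cvg_near_cst; near=> t; rewrite /u step_le0 ?subr0 ?mulr1//.
  rewrite mul1r subr_le0 ltW//; near: t; exact: nbhs_right_lt.
apply/W1pP; split => //.
  apply: (@bounded_energy _ 2 `|r|) => //; first exact: mf.
    move=> x; rewrite /u normrM ler_piMr// ger0_norm ?subr_ge0 ?step_le1//.
    by rewrite gerBl step_ge0.
  by move=> x x2; rewrite /u step_ge1 ?subrr ?mulr0//; lra.
rewrite (energy_weak_derivative p beta wu.1 (smooth_is_weak_derivative su)).
have [M M0 HM] := @derive1_step_bounded R.
apply: (@bounded_energy _ 2 (`|r| * M)) => //.
- by apply: mf; exact: smooth_derive.
- by move=> x; rewrite u' normrN normrM ler_wpM2l// ger0_norm// derive1_step_ge0.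
- move=> x x2; rewrite u' derive1_step_eq0 ?mulr0 ?oppr0//.
  by rewrite negb_and -!leNgt mul1r; apply/orP; right; lra.
Unshelve. all: by end_near. Qed.

End spaces.

Theorem theorem4p1 (R : realType) (p beta : R) (hp : 1 < p)
    (hbeta : beta < p - 1) :
  [/\
    (* (i) *)
    [/\ W1p0 p beta = A0 p beta, A0 p beta = B0 p beta,
        B0 p beta = C0 p beta & C0 p beta = Y1p p beta],
    (* (ii) *)
    (forall u, W1p p beta u -> cvg (u t @[t --> 0^'+])) /\
    (forall u, W1p p beta u ->
      t `^ ((beta - (p - 1)) / p) * `|u t - Tr0 u| @[t --> 0^'+] --> 0),
    (* (iii) *)
    (beta <= -1 ->
      [/\ W1p p beta = W1p0 p beta /\ W1p0 p beta = B0 p beta,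
          forall u, W1p p beta u -> Tr0 u = 0 &
          W1p p beta = W1p0 p beta /\
          [/\ W1p0 p beta = A0 p beta, A0 p beta = B0 p beta,
              B0 p beta = C0 p beta & C0 p beta = Y1p p beta]]) &
    (* (iv) *)
    (-1 < beta ->
      [/\ set_surj (W1p p beta) [set: R] Tr0,
          W1p0 p beta `<` W1p p beta &
          [/\ W1p0 p beta = A0 p beta, A0 p beta = B0 p beta,
              B0 p beta = C0 p beta & C0 p beta = Y1p p beta]])].
Proof.
have spaces : [/\ W1p0 p beta = A0 p beta, A0 p beta = B0 p beta,
    B0 p beta = C0 p beta & C0 p beta = Y1p p beta].
  have AB := A0_B0 hp hbeta; have BC := B0_C0 hp hbeta.
  split; [rewrite AB; exact: W1p0_B0|exact: AB|exact: BC|rewrite -BC; exact: B0_Y1p].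
have WB := W1p0_B0 hp hbeta.
split.
- exact: spaces.
- split=> u Wu; have [L uL _] := W1p_trace hp hbeta Wu.
    by apply/cvg_ex; exists L.
  by rewrite (Tr0_lim uL); exact: W1p_weighted_cvg.
- move=> b1.
  have trace0 u : W1p p beta u -> u t @[t --> 0^'+] --> (0 : R).
    move=> Wu; have [L uL _] := W1p_trace hp hbeta Wu.
    by have L0 := W1p_trace0 hp b1 Wu uL; rewrite L0 in uL.
  have W : W1p p beta = W1p0 p beta.
    by rewrite WB; apply/seteqP; split=> [u Wu|u []//]; split => //; exact: trace0.
  split; [by []| |by []].
  by move=> u Wu; apply: Tr0_lim; exact: trace0.
- move=> b1; have surj := trace_surj hp _ b1; split.
  + by move=> r _; have [u Wu ur] := surj r; exists u => //; exact: Tr0_lim.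
  + split; first by move=> u [].
    rewrite WB => H; have [u Wu u1] := surj 1.
    have [_ u0] := H _ Wu.
    have /= E := cvg_unique (@Rhausdorff R) u1 u0.
    by have := oner_neq0 R; rewrite E eqxx.
  + exact: spaces.
Qed.
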